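(* Let $n,m\in\mathbb{N}^*$, $T,L>0$, $0\le a<b\le L$, and let $f:\mathbb{R}^n\times\mathbb{R}^m\to\mathbb{R}^n$ be of class $C^2$. Consider the semilinear control system $$ \left\{\begin{array}{l} y_t+y_x=f(y,\Theta),\quad (t,x)\in[0,T]\times[0,L],\\ y(t,L)=y(t,0),\quad t\in[0,T],\\ y(0,x)=y^0(x),\quad x\in[0,L]. \end{array}\right.\qquad (N) $$ Let $(\tilde y,\tilde\Theta)$ be a trajectory of $(N)$. Assume that the linearization of $(N)$ around $(\tilde y,\tilde\Theta)$, that is the linear system $$ \left\{\begin{array}{l} y_t+y_x=\dfrac{\partial f}{\partial y}\big(\tilde y(t,x),\tilde\Theta(t,x)\big)y+\dfrac{\partial f}{\partial\Theta}\big(\tilde y(t,x),\tilde\Theta(t,x)\big)\Theta,\quad (t,x)\in[0,T]\times[0,L],\\ y(t,L)=y(t,0),\quad t\in[0,T],\\ y(0,x)=y^0(x),\quad x\in[0,L], \end{array}\right. $$ is exactly controllable at time $T$. Then $(N)$ is locally exactly controllable around the trajectory $(\tilde y,\tilde\Theta)$ at time $T$.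
   Context: Function spaces. $C^1_L([0,T]\times[0,L])^p$ (resp. $C^1_L([0,L])^p$) is the Banach space of $y\in C^1([0,T]\times[0,L])^p$ (resp. $y\in C^1([0,L])^p$) such that $\partial_x^iy(t,0)=\partial_x^iy(t,L)$ for all $t\in[0,T]$ and $i\in\{0,1\}$ (resp. $y^{(i)}(0)=y^{(i)}(L)$ for $i\in\{0,1\}$). Trajectory. A pair $(\tilde y,\tilde\Theta)\in C^1_L([0,T]\times[0,L])^n\times C^1_L([0,T]\times[0,L])^m$ is a trajectory of $(N)$ if it is a classical solution to $(N)$ for some $y^0\in C^1_L([0,L])^n$ and $\operatorname{supp}\tilde\Theta\subset[0,T]\times[a,b]$. Exact controllability of the linear system at time $T$: for every $y^0,y^1\in C^1_L([0,L])^n$ there exists $\Theta\in C^1_L([0,T]\times[0,L])^m$ with $\operatorname{supp}\Theta\subset[0,T]\times[a,b]$ such that the corresponding (unique, classical) solution $y\in C^1_L([0,T]\times[0,L])^n$ of the linear system satisfies $y(T,x)=y^1(x)$ for all $x\in[0,L]$. Local exact controllability of $(N)$ around $(\tilde y,\tilde\Theta)$ at time $T$: for every $\epsilon>0$ there exists $\mu>0$ such that for every $y^0,y^1\in C^1_L([0,L])^n$ with $\|y^0-\tilde y(0,\cdot)\|_{C^1}\le\mu$ and $\|y^1-\tilde y(T,\cdot)\|_{C^1}\le\mu$, there exist a control $\Theta\in C^1_L([0,T]\times[0,L])^m$ with $\operatorname{supp}\Theta\subset[0,T]\times[a,b]$ and a classical solution $y\in C^1_L([0,T]\times[0,L])^n$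 to $(N)$ such that $y(T,x)=y^1(x)$ for all $x\in[0,L]$, $\|y-\tilde y\|_{C^1}\le\epsilon$ and $\|\Theta-\tilde\Theta\|_{C^1}\le\epsilon$. *)

(* Defs.v *)
From HB Require Import structures.
From mathcomp Require Export all_boot all_order all_algebra.
From mathcomp Require Export all_classical all_reals all_analysis.

Set Implicit Arguments.
Unset Strict Implicit.
Unset Printing Implicit Defensive.

Export Order.TTheory GRing.Theory Num.Theory.
Export numFieldNormedType.Exports.

Local Open Scope classical_set_scope.
Local Open Scope ring_scope.

Section SegmentCalculus.
Context {R : realType} {W : normedModType R}.
Implicit Types (g : R -> W) (y : R * R -> W) (T L c s : R).

(* Difference quotients of g at s, restricted to increments that stay in the
   segment [0, c]: the derivative is one-sided at the endpoints, and the values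
   of g outside [0, c] are irrelevant. *)
Definition seg_quotient c g s : set_system W :=
  h^-1 *: (g (h + s) - g s) @[h --> within [set h | h + s \in `[0, c]] 0^'].

Definition seg_derivable c g s : Prop := cvg (seg_quotient c g s).

Definition seg_derive c g s : W := lim (seg_quotient c g s).

Definition sup_norm (U : Type) (A : set U) (u : U -> W) : R :=
  sup [set `|u z| | z in A].

Definition C1_seg L g : Prop :=
  [/\ {within `[0, L], continuous g},
      {in `[0, L], forall x, seg_derivable L g x} &
      {within `[0, L], continuous (seg_derive L g)}].

Definition C1per_seg L g : Prop :=
  [/\ C1_seg L g, g 0 = g L & seg_derive L g 0 = seg_derive L g L].

(* Real-valued sup: meaningful for g of class C^1, where the sets of values are
   bounded. Same remark for [C1norm_rect]. *)
Definition C1norm_seg L g : R :=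
  Num.max (sup_norm `[0, L] g) (sup_norm `[0, L] (seg_derive L g)).

Definition rect T L : set (R * R) := `[0, T] `*` `[0, L].

Definition dt T y (z : R * R) : W := seg_derive T (fun s => y (s, z.2)) z.1.

Definition dx L y (z : R * R) : W := seg_derive L (fun s => y (z.1, s)) z.2.

Definition C1_rect T L y : Prop :=
  [/\ {within rect T L, continuous y},
      forall t x, rect T L (t, x) ->
        seg_derivable T (fun s => y (s, x)) t /\
        seg_derivable L (fun s => y (t, s)) x,
      {within rect T L, continuous (dt T y)} &
      {within rect T L, continuous (dx L y)}].

Definition C1per_rect T L y : Prop :=
  C1_rect T L y /\
  {in `[0, T], forall t, y (t, 0) = y (t, L) /\ dx L y (t, 0) = dx L y (t, L)}.

Definition C1norm_rect T L y : R :=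
  Num.max (sup_norm (rect T L) y)
    (Num.max (sup_norm (rect T L) (dt T y)) (sup_norm (rect T L) (dx L y))).

Definition supported_in T L a b y : Prop :=
  closure [set z | rect T L z /\ y z != 0] `<=` `[0, T] `*` `[a, b].

End SegmentCalculus.

Section Regularity.
Context {R : realType} {V W : normedModType R}.

(* Continuity of the differential is required pointwise, at each fixed
   direction v; for finite-dimensional V, the only case used below, this is
   continuity for the operator norm. *)
Definition class_C1 (f : V -> W) : Prop :=
  (forall p, differentiable f p) /\ forall v, continuous (fun p => 'd f p v).

Definition class_C2 (f : V -> W) : Prop :=
  class_C1 f /\ forall v, class_C1 (fun p => 'd f p v).

End Regularity.

Section Control.
Context {R : realType} {n m : nat}.
Implicit Types (T L a b : R) (f : 'rV[R]_n * 'rV[R]_m -> 'rV[R]_n).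
Implicit Types (y : R * R -> 'rV[R]_n) (Theta : R * R -> 'rV[R]_m).

Definition admissible_control T L a b Theta : Prop :=
  C1per_rect T L Theta /\ supported_in T L a b Theta.

Definition classical_solution T L (F : R * R -> 'rV[R]_n -> 'rV[R]_n)
    (y0 : R -> 'rV[R]_n) y : Prop :=
  [/\ C1per_rect T L y,
      forall z, rect T L z -> dt T y z + dx L y z = F z (y z),
      {in `[0, T], forall t, y (t, L) = y (t, 0)} &
      {in `[0, L], forall x, y (0, x) = y0 x}].

Definition solution_N T L f Theta (y0 : R -> 'rV[R]_n) y : Prop :=
  classical_solution T L (fun z u => f (u, Theta z)) y0 y.

Definition trajectory T L a b f
    (ytilde : R * R -> 'rV[R]_n) (Thetatilde : R * R -> 'rV[R]_m) : Prop :=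
  admissible_control T L a b Thetatilde /\
  exists2 y0 : R -> 'rV[R]_n,
    C1per_seg L y0 & solution_N T L f Thetatilde y0 ytilde.

Definition df_dy f (u : 'rV[R]_n) (th : 'rV[R]_m) : 'rV[R]_n -> 'rV[R]_n :=
  'd (fun u' => f (u', th)) u.

Definition df_dTheta f (u : 'rV[R]_n) (th : 'rV[R]_m) :
    'rV[R]_m -> 'rV[R]_n :=
  'd (fun th' => f (u, th')) th.

Definition solution_linearized T L f (ytilde : R * R -> 'rV[R]_n)
    (Thetatilde : R * R -> 'rV[R]_m) Theta (y0 : R -> 'rV[R]_n) y : Prop :=
  classical_solution T L
    (fun z u => df_dy f (ytilde z) (Thetatilde z) u +
                df_dTheta f (ytilde z) (Thetatilde z) (Theta z)) y0 y.

Definition linearized_exactly_controllable T L a b f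
    (ytilde : R * R -> 'rV[R]_n) (Thetatilde : R * R -> 'rV[R]_m) : Prop :=
  forall y0 y1 : R -> 'rV[R]_n, C1per_seg L y0 -> C1per_seg L y1 ->
  exists Theta y,
    [/\ admissible_control T L a b Theta,
        solution_linearized T L f ytilde Thetatilde Theta y0 y &
        {in `[0, L], forall x, y (T, x) = y1 x}].

Definition locally_exactly_controllable T L a b f
    (ytilde : R * R -> 'rV[R]_n) (Thetatilde : R * R -> 'rV[R]_m) : Prop :=
  forall eps : R, 0 < eps -> exists2 mu : R, 0 < mu &
  forall y0 y1 : R -> 'rV[R]_n, C1per_seg L y0 -> C1per_seg L y1 ->
    C1norm_seg L (fun x => y0 x - ytilde (0, x)) <= mu ->
    C1norm_seg L (fun x => y1 x - ytilde (T, x)) <= mu ->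
  exists Theta y,
    [/\ admissible_control T L a b Theta,
        solution_N T L f Theta y0 y,
        {in `[0, L], forall x, y (T, x) = y1 x},
        C1norm_rect T L (fun z => y z - ytilde z) <= eps &
        C1norm_rect T L (fun z => Theta z - Thetatilde z) <= eps].

End Control.

(* Main.v *)
(** Apply the controllability of the linearized system to the data 0 and the
    constants e_i: this gives controls Theta_i steering 0 to e_i along linear
    solutions y_i. Since d/dt + d/dx annihilates every function of x - t, the
    combinations sum_i c_i(x - t) (y_i, Theta_i) are again linear solutions, and
    they steer 0 to c(x - T); this is an explicit bounded right inverse of the
    linear end-point map. For the nonlinear system look for
      y     = ytilde     + sum_i c_i(x - t) y_i(t, x) + w(t, x - t),
      Theta = Thetatilde + sum_i c_i(x - t) Theta_i(t, x).
    The equation becomes, on each characteristic xi = x - t, an ODE for w(., xi)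
    whose right-hand side is a Lipschitz linear term in w plus a quadratically
    small remainder in (w, c), with w(0, .) the error on the initial state and
    c = (error on the final state) - w(T, .). Picard iteration for w and its
    xi-derivative p converges in the norm weighted by exp(- 4 K t), because c
    enters only through the remainder. The remainder of p is the remainder of
    the tangent map (u, v) |-> df(u) v, which is C^1 because f is C^2. *)

(* Exact controllability gives a control for each pair of data but no estimate on it. The n pairs
   [(0, e_i)] leave finitely many C^1 functions on a compact rectangle, so bounds on them are
   automatic. Multiplication by [c_i(x - t)] respects the boundary condition because [c] is
   L-periodic, and it does not enlarge the support of a control. The obstacle is that T is
   arbitrary: the Lipschitz constant K in w is not small, and the weight repairs this only for terms
   evaluated at the current time. The term in c refers to time T and costs the full factor
   [expR (4 * K * T)]. Hence the order of the constants: K from f and a bound on the trajectory and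
   the linear solutions, then the Lipschitz constant [eta] in c against K and T, then a radius [r]
   on which [eta] is valid, and finally the size of the data. The derivative p is iterated along
   with w because uniform convergence of w alone would not give a C^1 limit in xi; the derivative in
   t comes from the ODE. *)
Require Import Defs.
From mathcomp Require Import ring lra.
Set Implicit Arguments.
Unset Strict Implicit.
Unset Printing Implicit Defensive.

Local Open Scope classical_set_scope.
Local Open Scope ring_scope.

(** * Linear identities in modules *)

Section ModuleExpressions.
Context {R : comNzRingType} {W : lmodType R}.

(** Syntax of linear combinations over a list of atoms: an identity between vectors is reduced to
    one scalar identity per atom. *)
Inductive mexp := MX of nat | M0 | MD of mexp & mexp | MN of mexp | MZ of R & mexp.

Fixpoint mexp_eval (env : seq W) e : W :=
  match e with
  | MX i => nth 0 env i
  | M0 => 0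
  | MD e1 e2 => mexp_eval env e1 + mexp_eval env e2
  | MN e1 => - mexp_eval env e1
  | MZ c e1 => c *: mexp_eval env e1
  end.

(** [eqn] computes on literal indices, so [/=] turns each coefficient into a plain ring
    expression. *)
Fixpoint mexp_coef e (i : nat) : R :=
  match e with
  | MX j => if eqn i j then 1 else 0
  | M0 => 0
  | MD e1 e2 => mexp_coef e1 i + mexp_coef e2 i
  | MN e1 => - mexp_coef e1 i
  | MZ c e1 => c * mexp_coef e1 i
  end.

Fixpoint same_coefs e1 e2 (n : nat) : Prop :=
  if n is n'.+1 then mexp_coef e1 n' = mexp_coef e2 n' /\ same_coefs e1 e2 n'
  else True.

Lemma mexp_evalE env e :
  mexp_eval env e = \sum_(i < size env) mexp_coef e i *: nth 0 env i.
Proof.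
elim: e => [j||e1 IH1 e2 IH2|e1 IH1|c e1 IH1] /=.
- have [js|js] := ltnP j (size env).
    rewrite (bigD1 (Ordinal js)) //= -[eqn _ _]/(j == j) eqxx scale1r big1 ?addr0 // => i /eqP ij.
    rewrite -[eqn _ _]/(nat_of_ord i == j); case: eqP => [e|]; last by rewrite scale0r.
    by case: ij; apply/val_inj.
  rewrite nth_default // big1 // => i _.
  rewrite -[eqn _ _]/(nat_of_ord i == j); case: eqP => [e|]; last by rewrite scale0r.
  by have := ltn_ord i; rewrite e ltnNge js.
- by rewrite big1 // => i _; rewrite scale0r.
- by rewrite IH1 IH2 -big_split; apply: eq_bigr => i _; rewrite scalerDl.
- by rewrite IH1 -sumrN; apply: eq_bigr => i _; rewrite scaleNr.
- by rewrite IH1 scaler_sumr; apply: eq_bigr => i _; rewrite scalerA.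
Qed.

Lemma mexp_eq env e1 e2 :
  same_coefs e1 e2 (size env) -> mexp_eval env e1 = mexp_eval env e2.
Proof.
move=> H; rewrite !mexp_evalE; apply: eq_bigr => i _; congr (_ *: _).
elim: (size env) H i => [_ []//|k IH /= [ek H] i].
case: (unliftP ord_max i) => [j ->|->] //.
by have := IH H j; rewrite lift_max.
Qed.

End ModuleExpressions.

Ltac mexp_index env x :=
  lazymatch env with
  | ?y :: ?env' => match constr:(Set) with
      | _ => let _ := match constr:(Set) with _ => constr_eq x y end in constr:(O)
      | _ => let i := mexp_index env' x in constr:(S i) end
  end.

Ltac mexp_atoms env t :=
  lazymatch t with
  | 0 => env
  | ?a + ?b => let env := mexp_atoms env a in mexp_atoms env b
  | - ?a => mexp_atoms env a
  | _ *: ?a => mexp_atoms env a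
  | ?x => match constr:(Set) with
      | _ => let _ := mexp_index env x in env
      | _ => constr:(x :: env) end
  end.

Ltac mexp_reify R env t :=
  lazymatch t with
  | 0 => constr:(@M0 R)
  | ?a + ?b => let a := mexp_reify R env a in let b := mexp_reify R env b in
               constr:(MD a b)
  | - ?a => let a := mexp_reify R env a in constr:(MN a)
  | ?c *: ?a => let a := mexp_reify R env a in constr:(@MZ R c a)
  | ?x => let i := mexp_index env x in constr:(@MX R i)
  end.

(* Atoms are compared syntactically; the resulting identities between
   coefficients are left to [ring]. *)
Ltac lmod_eq R :=
  lazymatch goal with
  | |- @eq ?W ?a ?b =>
    let env := mexp_atoms (@nil W) a in
    let env := mexp_atoms env b in
    let ea := mexp_reify R env a in
    let eb := mexp_reify R env b in
    apply: (@mexp_eq R _ env ea eb);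
    rewrite /=; repeat split; ring
  end.

(** * Derivatives relative to a set and the mean value inequality *)

Section PointwiseDerivative.
Context {R : realType}.
Implicit Types (V W : normedModType R) (A : set R) (s t d : R).

(** Written without a quotient, so that sums, products and compositions are plain norm estimates.
    With [A = setT] it is the usual derivative; on a segment it is one-sided at the endpoints, as in
    [seg_derive]. *)
Definition has_der W A (g : R -> W) s (v : W) : Prop :=
  forall e : R, 0 < e -> exists2 d : R, 0 < d & forall t, A t -> `|t - s| < d ->
    `|g t - g s - (t - s) *: v| <= e * `|t - s|.

Lemma has_der_sub W A B (g : R -> W) s v :
  B `<=` A -> has_der A g s v -> has_der B g s v.
Proof.
move=> BA gv e /gv[d d0 H]; exists d => // t /BA; exact: H.
Qed.

Lemma has_der_eq W A (g h : R -> W) s v : A s -> (forall t, A t -> g t = h t) ->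
  has_der A g s v -> has_der A h s v.
Proof.
move=> As gh gv e /gv[d d0 H]; exists d => // t At; rewrite -!gh //; exact: H.
Qed.

Lemma has_der_cst W A (u : W) s : has_der A (fun=> u) s 0.
Proof.
move=> e e0; exists 1 => // t _ _.
by rewrite subrr scaler0 subr0 normr0 mulr_ge0 // ltW.
Qed.

Lemma has_der_scale W A (u : W) s : has_der A (fun t => t *: u) s u.
Proof.
move=> e e0; exists 1 => // t _ _.
by rewrite -scalerBl subrr normr0 mulr_ge0 // ltW.
Qed.

Lemma has_der_mull A (k s : R) : has_der A ( *%R k) s k.
Proof.
move=> e e0; exists 1 => // t _ _.
have -> : k * t - k * s - (t - s) * k = 0 by ring.
by rewrite normr0 mulr_ge0 // ltW.
Qed.

Lemma has_derD W A (g h : R -> W) s v w : has_der A g s v -> has_der A h s w ->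
  has_der A (fun t => g t + h t) s (v + w).
Proof.
move=> gv hw e e0.
have e20 : 0 < e / 2 by rewrite divr_gt0.
have [d1 d10 H1] := gv _ e20; have [d2 d20 H2] := hw _ e20.
exists (Num.min d1 d2); first by rewrite lt_min d10.
move=> t At; rewrite lt_min => /andP[/(H1 _ At) h1 /(H2 _ At) h2].
rewrite [leRHS](_ : _ = e / 2 * `|t - s| + e / 2 * `|t - s|); last by field.
apply: le_trans (lerD h1 h2); apply: le_trans (ler_normD _ _).
by rewrite le_eqVlt; apply/orP; left; apply/eqP; congr (`|_|); lmod_eq R.
Qed.

(** The chain rule for a bounded linear map, given as a bare function so that negation, scaling,
    coordinates and the inclusion [iota] all qualify. *)
Lemma has_der_lip V W A (g : R -> V) s v (l : V -> W) (k : R) :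
  (forall x y, l (x - y) = l x - l y) -> (forall c x, l (c *: x) = c *: l x) ->
  (forall x, `|l x| <= k * `|x|) ->
  has_der A g s v -> has_der A (l \o g) s (l v).
Proof.
move=> lB lZ lk gv e e0.
have k10 : 0 < `|k| + 1 by rewrite ltr_pwDr.
have [d d0 H] := gv (e / (`|k| + 1)) (divr_gt0 e0 k10).
exists d => // t At ts; rewrite /= -lB -lZ -lB.
apply: le_trans (lk _) _.
have ke : k <= `|k| + 1 by rewrite (le_trans (ler_norm _)) // lerDl.
apply: le_trans (ler_wpM2r (normr_ge0 _) ke) _.
apply: le_trans (ler_wpM2l (ltW k10) (H t At ts)) _.
by rewrite mulrA [_ * (e / _)]mulrC divfK // gt_eqF.
Qed.

Lemma has_derN W A (g : R -> W) s v :
  has_der A g s v -> has_der A (fun t => - g t) s (- v).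
Proof.
apply: (@has_der_lip _ _ _ _ _ _ -%R 1) => [x y|c x|x].
- by rewrite opprD.
- by rewrite scalerN.
- by rewrite normrN mul1r.
Qed.

Lemma has_derB W A (g h : R -> W) s v w : has_der A g s v -> has_der A h s w ->
  has_der A (fun t => g t - h t) s (v - w).
Proof. by move=> gv hw; apply: has_derD gv (has_derN hw). Qed.

Lemma has_derZl W A (k : R) (g : R -> W) s v :
  has_der A g s v -> has_der A (fun t => k *: g t) s (k *: v).
Proof.
apply: (@has_der_lip _ _ _ _ _ _ ( *:%R k) `|k|) => [x y|c x|x].
- by rewrite scalerBr.
- by rewrite !scalerA mulrC.
- by rewrite normrZ.
Qed.

Lemma has_der_sum W A (I : finType) (g : I -> R -> W) s v :
  (forall i, has_der A (g i) s (v i)) ->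
  has_der A (fun t => \sum_i g i t) s (\sum_i v i).
Proof.
move=> gv; rewrite (_ : (fun t => _) = \sum_i g i); last first.
  by apply/funext => t; rewrite fct_sumE.
elim/big_ind2 : _ => [|f u h w fu hw|i _].
- exact: has_der_cst.
- exact: has_derD.
- exact: gv.
Qed.

Lemma has_der_cont W A (g : R -> W) s v : has_der A g s v ->
  forall e : R, 0 < e -> exists2 d : R, 0 < d &
    forall t, A t -> `|t - s| < d -> `|g t - g s| < e.
Proof.
move=> gv e e0; have [d d0 H] := gv 1 ltr01.
have v10 : 0 < `|v| + 1 by rewrite ltr_pwDr.
exists (Num.min d (e / (`|v| + 1))).
  by rewrite lt_min d0 divr_gt0.
move=> t At; rewrite lt_min => /andP[/(H _ At) h]; rewrite ltr_pdivlMr // => h2.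
apply: le_lt_trans h2.
rewrite -[g t - g s](subrK ((t - s) *: v)); apply: le_trans (ler_normD _ _) _.
by rewrite mulrDr mulr1 addrC normrZ lerD // -[`|t - s|]mul1r.
Qed.

Lemma has_derZ W A (k : R -> R) (g : R -> W) s a v :
  has_der A k s a -> has_der A g s v ->
  has_der A (fun t => k t *: g t) s (k s *: v + a *: g s).
Proof.
move=> ka gv e e0.
(* [m] dominates the three factors [k t], [v] and [g s] of the product rule; cutting [e'] off at 1
   keeps [k t] within 1 of [k s]. *)
pose m : R := `|k s| + 1 + `|v| + `|g s|.
have m0 : 0 < m by rewrite /m -!addrA addrCA ltr_pwDl// !addr_ge0.
pose e' := Num.min 1 (e / (3 * m)).
have e'0 : 0 < e' by rewrite lt_min ltr01 /= divr_gt0 // mulr_gt0.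
have [d1 d10 H1] := ka _ e'0; have [d2 d20 H2] := gv _ e'0.
have [d3 d30 H3] := has_der_cont ka e'0.
exists (Num.min d1 (Num.min d2 d3)); first by rewrite !lt_min d10 d20.
move=> t At; rewrite !lt_min.
move=> /and3P[/(H1 _ At) h1 /(H2 _ At) h2 /(H3 _ At) h3].
have -> : k t *: g t - k s *: g s - (t - s) *: (k s *: v + a *: g s) =
  k t *: (g t - g s - (t - s) *: v) + ((t - s) * (k t - k s)) *: v
  + (k t - k s - (t - s) * a) *: g s.
  by lmod_eq R.
apply: le_trans (ler_normD _ _) _.
apply: le_trans (lerD (ler_normD _ _) (lexx _)) _.
rewrite !normrZ ?normrM.
have kt : `|k t| <= m.
  rewrite -[k t](subrK (k s)) addrC (le_trans (ler_normD _ _))// /m.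
  rewrite -!addrA lerD2l (le_trans (ltW h3))// (@le_trans _ _ 1) //.
    by rewrite ge_min lexx.
  by rewrite lerDl addr_ge0.
have vm : `|v| <= m by rewrite /m addrAC lerDr !addr_ge0.
have gm : `|g s| <= m by rewrite /m lerDr !addr_ge0.
have e'e : e' <= e / (3 * m) by rewrite ge_min lexx orbT.
have -> : e * `|t - s| = m * (e / (3 * m) * `|t - s|) +
  `|t - s| * (e / (3 * m)) * m + e / (3 * m) * `|t - s| * m.
  by field; rewrite gt_eqF.
have q0 : 0 <= e / (3 * m) by rewrite ltW // divr_gt0 // mulr_gt0.
apply: lerD; [apply: lerD|]; apply: ler_pM => //.
- by rewrite (le_trans h2) // ler_wpM2r.
- by rewrite ler_wpM2l // (le_trans (ltW h3)).
- by rewrite (le_trans h1) // ler_wpM2r.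
Qed.

(* Real induction: with slack [e], the supremum [c] of the points up to which the
   bound holds satisfies the bound, and lies at [b] because the derivatives at [c]
   carry the bound past [c]. *)
Lemma mean_value_le W (g g' : R -> W) (phi phi' : R -> R) (a b : R) : a <= b ->
  (forall s, s \in `[a, b] -> has_der `[a, b] g s (g' s)) ->
  (forall s, s \in `[a, b] -> has_der `[a, b] phi s (phi' s)) ->
  (forall s, s \in `[a, b] -> `|g' s| <= phi' s) ->
  `|g b - g a| <= phi b - phi a.
Proof.
move=> ab gg pp gp; apply/ler_addgt0Pr => e0 e00.
pose e := e0 / (b - a + 1).
have ba1 : 0 < b - a + 1 by rewrite ltr_pwDr // subr_ge0.
have e_gt0 : 0 < e by rewrite divr_gt0.
suff H : `|g b - g a| <= phi b - phi a + e * (b - a).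
  apply: le_trans H _; rewrite lerD2l /e mulrAC ler_pdivrMr //.
  by rewrite ler_pM2l // lerDl.
(* Half of the slack absorbs the first-order error of [g], the other half that of [phi]. *)
have e20 : 0 < e / 2 by rewrite divr_gt0.
pose S := [set s | s \in `[a, b] /\
  forall u, u \in `[a, s] -> `|g u - g a| <= phi u - phi a + e * (u - a)].
have loc s : s \in `[a, b] -> exists2 d, 0 < d & forall t, t \in `[a, b] ->
    `|t - s| < d -> `|g t - g s - (t - s) *: g' s| <= e / 2 * `|t - s| /\
      `|phi t - phi s - (t - s) * phi' s| <= e / 2 * `|t - s|.
  move=> sab; have [d1 d10 H1] := gg s sab _ e20.
  have [d2 d20 H2] := pp s sab _ e20.
  exists (Num.min d1 d2); first by rewrite lt_min d10.
  move=> t tab; rewrite lt_min => /andP[t1 t2]; split; first exact: H1.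
  exact: H2.
have Sa : S a.
  split; first by rewrite in_itv /= lexx ab.
  move=> u; rewrite in_itv /= => /andP[au ua].
  have -> : u = a by apply/le_anti; rewrite au ua.
  by rewrite !subrr mulr0 addr0 normr0.
have Sub : has_ubound S by exists b => s [/[!in_itv]/andP[]].
have Ssup : has_sup S by split; [exists a | ].
pose c := sup S.
have ac : a <= c by apply: ub_le_sup.
have cb : c <= b.
  by apply: ge_sup; [exists a | move=> s [/[!in_itv]/andP[]]].
have cab : c \in `[a, b] by rewrite in_itv /= ac.
have Slt u : u \in `[a, b] -> u < c ->
    `|g u - g a| <= phi u - phi a + e * (u - a).
  move=> /[!in_itv]/= /andP[au ub] uc.
  have [s [sab Hs] us] := sup_gt (ex_intro _ a Sa : S !=set0) uc.
  by apply: Hs; rewrite in_itv /= au ltW.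
have [d d0 Hd] := loc c cab.
have Sc : `|g c - g a| <= phi c - phi a + e * (c - a).
  have [ca|ca] := eqVneq c a.
    by rewrite ca !subrr mulr0 addr0 normr0.
  have {ca}ac' : a < c by rewrite lt_neqAle eq_sym ca.
  pose u := Num.max a (c - d / 2).
  have uc : u < c by rewrite gt_max ac' /= ltrBlDr ltrDl divr_gt0.
  have uab : u \in `[a, b] by rewrite in_itv /= le_max lexx /= (le_trans (ltW uc)).
  have := Slt u uab uc.
  have ucd : `|u - c| < d.
    rewrite distrC gtr0_norm ?subr_gt0 // ltrBlDl -ltrBlDr.
    rewrite lt_max; apply/orP; right; lra.
  have [] := Hd u uab ucd.
  have -> : `|u - c| = c - u by rewrite distrC gtr0_norm ?subr_gt0.
  move=> h1 h2 h3.
  have h4 := gp c cab.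
  have h5 : `|g c - g u| <= (c - u) * phi' c + e / 2 * (c - u).
    rewrite -[g c - g u](addrNK ((c - u) *: g' c)).
    apply: le_trans (ler_normD _ _) _; rewrite addrC lerD //.
      by rewrite normrZ gtr0_norm ?subr_gt0 // ler_pM2l // subr_gt0.
    apply: le_trans h1; rewrite -normrN le_eqVlt; apply/orP; left; apply/eqP.
    by congr (`|_|); lmod_eq R.
  have h6 := ler_distD (g u) (g c) (g a).
  move: h2; rewrite ler_norml => /andP[h2 h2'].
  nra.
have [cb'|cb'] := eqVneq c b; first by rewrite -cb'.
have {cb'} cltb : c < b by rewrite lt_neqAle cb'.
pose v := Num.min b (c + d / 2).
have cv : c < v by rewrite lt_min cltb ltrDl divr_gt0.
have vb : v <= b by rewrite ge_min lexx.
suff Sv : S v by have := ub_le_sup Sub Sv; rewrite -/c leNgt cv.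
split; first by rewrite in_itv /= (le_trans ac (ltW cv)).
move=> u /[!in_itv]/= /andP[au uv].
have [uc|cu] := ltP u c.
  by apply: Slt => //; rewrite in_itv /= au (le_trans uv).
have uab : u \in `[a, b] by rewrite in_itv /= au (le_trans uv).
have ucd : `|u - c| < d.
  rewrite ger0_norm ?subr_ge0 // ltrBlDl (le_lt_trans uv) //.
  rewrite gt_min; apply/orP; right; lra.
have [] := Hd u uab ucd.
have -> : `|u - c| = u - c by rewrite ger0_norm ?subr_ge0.
move=> h1 h2.
have h4 := gp c cab.
have h5 : `|g u - g c| <= (u - c) * phi' c + e / 2 * (u - c).
  rewrite -[g u - g c](subrK ((u - c) *: g' c)).
  apply: le_trans (ler_normD _ _) _; rewrite addrC lerD //.
  by rewrite normrZ ger0_norm ?subr_ge0 // ler_wpM2l // subr_ge0.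
have h6 := ler_distD (g c) (g u) (g a).
move: h2; rewrite ler_norml => /andP[h2 h2'].
nra.
Qed.

(** The mean value inequality for [g z - z *: c] against the slope [M]. Closeness is measured by the
    distance to [x], so [y] may lie on either side. *)
Lemma mean_value_segment W (g g' : R -> W) (c : W) (M x y : R) :
  (forall z, has_der setT g z (g' z)) ->
  (forall z, `|z - x| <= `|y - x| -> `|g' z - c| <= M) ->
  `|g y - g x - (y - x) *: c| <= M * `|y - x|.
Proof.
move=> gg gM.
have key a b : a <= b -> `|a - x| <= `|y - x| -> `|b - x| <= `|y - x| ->
    `|(g b - b *: c) - (g a - a *: c)| <= M * b - M * a.
  move=> ab ax bx; apply: (@mean_value_le _ (fun z => g z - z *: c)
    (fun z => g' z - c) (fun z => M * z) (fun=> M)) => // z zab.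
  - apply: (@has_der_sub _ setT) => //.
    by apply: has_derB; [exact: gg|exact: has_der_scale].
  - exact: has_der_mull.
  - move: zab; rewrite in_itv /= => /andP[az zb]; apply: gM.
    by move: ax bx; rewrite !ler_norml => /andP[? ?] /andP[? ?]; apply/andP; split; lra.
have xx : `|x - x| <= `|y - x| by rewrite subrr normr0.
have -> : g y - g x - (y - x) *: c = (g y - y *: c) - (g x - x *: c).
  by lmod_eq R.
have [xy|/ltW yx] := leP x y.
  by have := key x y xy xx (lexx _); rewrite -mulrBr [`|y - x|]ger0_norm ?subr_ge0.
have := key y x yx (lexx _) xx.
by rewrite -mulrBr distrC [`|y - x|]distrC [`|x - y|]ger0_norm ?subr_ge0.
Qed.

End PointwiseDerivative.

(** * Continuity, compactness and the chain rule *)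

Section Continuity.
Context {R : realType}.
Implicit Types (U V W : normedModType R).

Lemma cont_atP V W (g : V -> W) p : {for p, continuous g} <->
  forall e : R, 0 < e -> exists2 d : R, 0 < d &
    forall q, `|q - p| < d -> `|g q - g p| < e.
Proof.
rewrite /prop_for /continuous_at cvgrPdist_lt; split=> H e /H.
  move=> /nbhs_ballP[d d0 Hd]; exists d => // q qp.
  by rewrite distrC; apply: Hd; rewrite -ball_normE /= distrC.
move=> [d d0 Hd]; apply/nbhs_ballP; exists d => // q.
by rewrite -ball_normE /= distrC => /Hd; rewrite distrC.
Qed.

Lemma within_contP V W (A : set V) (g : V -> W) : {within A, continuous g} <->
  forall p, A p -> forall e : R, 0 < e -> exists2 d : R, 0 < d &
    forall q, A q -> `|q - p| < d -> `|g q - g p| < e.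
Proof.
rewrite subspace_continuousP; split=> H p Ap; last first.
  apply/cvgrPdist_lt => e /(H p Ap)[d d0 Hd]; apply/nbhs_ballP; exists d => // q.
  by rewrite -ball_normE /= distrC => qp Aq; rewrite distrC; apply: Hd.
move=> e e0; have /cvgrPdist_lt/(_ e e0)/nbhs_ballP[d d0 Hd] := H p Ap.
exists d => // q Aq qp; rewrite distrC; apply: Hd => //.
by rewrite -ball_normE /= distrC.
Qed.

(** Heine-Cantor with only [p] confined to [K]: continuity at the points of [K] holds in the ambient
    space, so [q] may leave [K]. In the covering form of compactness the radius is the parameter,
    tending to 0 from the right. *)
Lemma compact_unif_cont V W (K : set V) (g : V -> W) : compact K ->
  (forall p, K p -> {for p, continuous g}) ->
  forall e : R, 0 < e -> exists2 d : R, 0 < d &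
    forall p q, K p -> `|q - p| < d -> `|g q - g p| < e.
Proof.
move=> /compact_near_coveringP cK cg e e0.
have e20 : 0 < e / 2 by rewrite divr_gt0.
have := cK R (0^'+) (fun d p => forall q, `|q - p| < d -> `|g q - g p| < e) _.
case=> [p Kp|d /= d0 H]; last first.
  exists (d / 2); first by rewrite divr_gt0.
  move=> p q Kp qp; apply: (H (d / 2)) => //=; last by rewrite divr_gt0.
  by rewrite /ball_ /= sub0r normrN gtr0_norm ?divr_gt0 // ltr_pdivrMr // ltr_pMr // ltrDl.
have /cont_atP/(_ _ e20)[d d0 Hd] := cg p Kp.
have d20 : 0 < d / 2 by rewrite divr_gt0.
exists (ball p (d / 2), [set x | 0 < x < d / 2]).
  split; first exact: nbhsx_ballx.
  exists (d / 2) => //= x; rewrite /ball_ /= sub0r normrN => xd x0.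
  by rewrite gtr0_norm // in xd; rewrite x0.
move=> [u x] /= [pu /andP[x0 xd]] q qu.
rewrite -ball_normE /= in pu.
have h1 : `|u - p| < d by rewrite distrC (lt_trans pu) // ltr_pdivrMr // ltr_pMr // ltrDl.
have h2 : `|q - p| < d.
  rewrite (le_lt_trans (ler_distD u _ _)) // [ltRHS]splitr ltrD //.
    exact: lt_trans xd.
  by rewrite distrC.
rewrite (le_lt_trans (ler_distD (g p) _ _)) // [ltRHS]splitr ltrD //.
  exact: Hd.
by rewrite distrC; apply: Hd.
Qed.

Lemma compact_bound V W (K : set V) (g : V -> W) : compact K ->
  {within K, continuous g} ->
  exists2 M : R, 0 < M & forall p, K p -> `|g p| <= M.
Proof.
move=> cK cg; have := compact_bounded (continuous_compact cg cK).
rewrite /bounded_set /bounded_near => -[M [_ HM]].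
exists (Num.max 1 (M + 1)); first by rewrite lt_max ltr01.
move=> p Kp; apply: (HM (Num.max 1 (M + 1))); last by exists p.
by rewrite lt_max [M < M + 1]ltrDl ltr01 orbT.
Qed.

Lemma continuous_sum (T : topologicalType) W (I : finType) (g : I -> T -> W) :
  (forall i, continuous (g i)) -> continuous (fun t => \sum_i g i t).
Proof.
move=> cg; rewrite (_ : (fun t => _) = \sum_i g i); last first.
  by apply/funext => t; rewrite fct_sumE.
apply: (big_ind (fun h : T -> W => continuous h)) => [|h k ch ck|i _].
- exact: cst_continuous.
- by move=> t; apply: cvgD; [exact: ch|exact: ck].
- exact: cg.
Qed.

Lemma continuous_at_pair (S T T' : topologicalType) (f : S -> T) (g : S -> T') s :
  {for s, continuous f} -> {for s, continuous g} ->
  {for s, continuous (fun s => (f s, g s))}.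
Proof.
move=> cf cg; exact: (@cvg_pair _ _ _ (nbhs s) (nbhs (f s)) (nbhs (g s))).
Qed.

Lemma pair_norm_lt U V (p : U * V) (d : R) :
  (`|p| < d) = (`|p.1| < d) && (`|p.2| < d).
Proof. by rewrite prod_normE gt_max. Qed.

Lemma pair_norm_le U V (p : U * V) (d : R) :
  (`|p| <= d) = (`|p.1| <= d) && (`|p.2| <= d).
Proof. by rewrite prod_normE ge_max. Qed.

Lemma has_der_pair U V A (g : R -> U) (h : R -> V) s u v :
  has_der A g s u -> has_der A h s v ->
  has_der A (fun t => (g t, h t)) s (u, v).
Proof.
move=> gu hv e e0; have [d1 d10 H1] := gu e e0; have [d2 d20 H2] := hv e e0.
exists (Num.min d1 d2); first by rewrite lt_min d10.
move=> t At; rewrite lt_min => /andP[t1 t2].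
by rewrite pair_norm_le /= H1 //= H2.
Qed.

Lemma diff_approx V W (f : V -> W) p : differentiable f p ->
  forall e : R, 0 < e -> exists2 d : R, 0 < d & forall q, `|q - p| < d ->
    `|f q - f p - 'd f p (q - p)| <= e * `|q - p|.
Proof.
move=> /diff_locally/eqaddoP fp e e0.
have /nbhs_ballP[d d0 Hd] := fp e e0.
exists d => // q qp; have := Hd (q - p).
rewrite -ball_normE /= sub0r normrN => /(_ qp).
by rewrite !fctE /= subrK opprD addrA.
Qed.

Lemma diff_lip V W (f : V -> W) p : differentiable f p ->
  exists2 k : R, 0 < k & forall v, `|'d f p v| <= k * `|v|.
Proof. by move=> /diff_continuous/linear_lipschitz. Qed.

(** [l] is a bare function because the derivative of the tangent map will be an explicit formula
    rather than a ['d]. *)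
Definition frechet V W (f : V -> W) (p : V) (l : V -> W) : Prop :=
  [/\ forall x y, l (x - y) = l x - l y,
      forall (c : R) x, l (c *: x) = c *: l x,
      exists2 k : R, 0 < k & forall v, `|l v| <= k * `|v| &
      forall e : R, 0 < e -> exists2 d : R, 0 < d & forall q, `|q - p| < d ->
        `|f q - f p - l (q - p)| <= e * `|q - p|].

Lemma frechet_diff V W (f : V -> W) p :
  differentiable f p -> frechet f p ('d f p).
Proof.
move=> df; split; [exact: linearB|by move=> c x; rewrite linearZ|exact: diff_lip|].
exact: diff_approx.
Qed.

Lemma frechet0 V W (f : V -> W) p l : frechet f p l -> l 0 = 0.
Proof. by move=> [_ lZ _ _]; have := lZ 0 0; rewrite !scale0r. Qed.

Lemma has_der_comp V W A (f l : V -> W) (g : R -> V) s v :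
  frechet f (g s) l -> has_der A g s v -> has_der A (f \o g) s (l v).
Proof.
move=> [lB lZ [k k0 Hk] fl] gv e e0.
have v10 : 0 < `|v| + 1 by rewrite ltr_pwDr.
(* [e1] pays for the remainder of [f], the increment of [g] being at most |v| + 1 times |t - s|. The
   bound 1 in [e2] gives that estimate; its other bound pays for [l] applied to the remainder of
   [g]. *)
pose e1 : R := e / (2 * (`|v| + 1)).
have e10 : 0 < e1 by rewrite divr_gt0 // mulr_gt0.
have [d1 d10 H1] := fl _ e10.
pose e2 : R := Num.min 1 (e / (2 * k)).
have e20 : 0 < e2 by rewrite lt_min ltr01 divr_gt0 // mulr_gt0.
have [d2 d20 H2] := gv _ e20; have [d3 d30 H3] := has_der_cont gv d10.
exists (Num.min d2 d3); first by rewrite lt_min d20.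
move=> t At; rewrite lt_min => /andP[/(H2 _ At) h2 /(H3 _ At)/H1 h1] /=.
have -> : f (g t) - f (g s) - (t - s) *: l v =
   (f (g t) - f (g s) - l (g t - g s)) + l (g t - g s - (t - s) *: v).
  by rewrite [X in _ = _ + X]lB [X in _ = _ + (_ - X)]lZ; lmod_eq R.
apply: le_trans (ler_normD _ _) _.
have -> : e * `|t - s| = e1 * ((`|v| + 1) * `|t - s|) + k * (e / (2 * k) * `|t - s|).
  by rewrite /e1; field; rewrite !gt_eqF.
apply: lerD.
  apply: le_trans h1 _; apply: ler_wpM2l; first exact: ltW.
  have -> : g t - g s = (t - s) *: v + (g t - g s - (t - s) *: v) by lmod_eq R.
  apply: le_trans (ler_normD _ _) _; rewrite normrZ mulrDl mul1r mulrC lerD2l.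
  by rewrite (le_trans h2) // -[leRHS]mul1r ler_wpM2r // ge_min lexx.
apply: le_trans (Hk _) _; apply: ler_wpM2l; first exact: ltW.
apply: le_trans h2 _; apply: ler_wpM2r => //.
by rewrite ge_min lexx orbT.
Qed.

Lemma is_derive_has_der (g : R -> R) (s v : R) : is_derive s 1 g v -> has_der setT g s v.
Proof.
move=> gv; have dg : differentiable g s.
  by apply/derivable1_diffP; case: gv.
move=> e e0; have [d d0 H] := diff_approx dg e0; exists d => // t _ ts.
have -> : (t - s) *: v = 'd g s (t - s).
  rewrite -[t - s in RHS]mulr1 [RHS]linearZ /=; congr (_ *: _).
  by rewrite -deriveE //; case: gv.
exact: H.
Qed.

Lemma continuous_has_der W (g : R -> W) s v : has_der setT g s v ->
  {for s, continuous g}.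
Proof.
move=> gv; apply/cont_atP => e e0; have [d d0 H] := has_der_cont gv e0.
by exists d => // t; apply: H.
Qed.

Lemma has_der_expR (k s : R) :
  has_der setT (fun t => expR (k * t)) s (expR (k * s) * k).
Proof.
apply: is_derive_has_der; apply: is_derive1_comp.
have := @is_deriveZ R R R id k s 1 1 (is_derive_id _ _).
by rewrite /GRing.scale /= mulr1.
Qed.

End Continuity.

(** * Primitives of vector-valued functions and uniform limits *)

Section Primitive.
Context {R : realType} {n : nat}.
Local Notation W := 'rV[R]_n.
Local Notation mu := (@lebesgue_measure R).

Lemma has_der_row A (g : R -> W) s (v : W) :
  (forall j, has_der A (fun t => g t 0 j) s (v 0 j)) -> has_der A g s v.
Proof.
move=> gv; have -> : g = fun t => \sum_j g t 0 j *: 'e_j.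
  by apply/funext => t; rewrite -row_sum_delta.
rewrite [v]row_sum_delta; apply: has_der_sum => j.
have := has_derZ (gv j) (has_der_cst A ('e_j : W) s).
by rewrite scaler0 add0r.
Qed.

(* The primitive of [g] vanishing at [0]; starting the integral at [-1] makes it
   differentiable on both sides at [0]. *)
Definition prim (g : R -> W) (t : R) : W :=
  \row_j (\int[mu]_(s in `[(-1)%R, t]) g s 0 j -
          \int[mu]_(s in `[(-1)%R, 0%R]) g s 0 j).

Lemma prim0 g : prim g 0 = 0.
Proof. by apply/rowP => j; rewrite !mxE subrr. Qed.

Lemma has_der_prim g t : continuous g -> 0 <= t -> has_der setT (prim g) t (g t).
Proof.
move=> cg t0; apply: has_der_row => j; rewrite -[g t 0 j]subr0.
have cgj : continuous (fun s => g s 0 j).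
  move=> s; apply: (@continuous_comp _ _ _ g (fun v : W => v 0 j)); first exact: cg.
  exact: coord_continuous.
rewrite (_ : (fun s => prim g s 0 j) = fun s => \int[mu]_(u in `[(-1)%R, s]) g u 0 j -
   \int[mu]_(u in `[(-1)%R, 0%R]) g u 0 j); last first.
  by apply/funext => s; rewrite mxE.
apply: has_derB; last exact: has_der_cst.
apply: is_derive_has_der.
have t1 : t < t + 1 by rewrite ltrDl.
have mt : -1 < t by rewrite (lt_le_trans _ t0) // oppr_lt0.
have [|dF F'] := continuous_FTC1_closed t1 _ mt (cgj t).
  apply: continuous_compact_integrable; first exact: segment_compact.
  exact: continuous_subspaceT.
by apply: (DeriveDef dF); rewrite -derive1E F'.
Qed.

(** The majorant is given through its own primitive [phi], so that an exponential weight is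
    integrated by exhibiting an antiderivative. *)
Lemma prim_le (g h : R -> W) (phi phi' : R -> R) (t : R) :
  continuous g -> continuous h -> 0 <= t ->
  (forall s, s \in `[0, t] -> has_der setT phi s (phi' s)) ->
  (forall s, s \in `[0, t] -> `|g s - h s| <= phi' s) ->
  `|prim g t - prim h t| <= phi t - phi 0.
Proof.
move=> cg ch t0 pp gh.
have := @mean_value_le _ _ (fun s => prim g s - prim h s) (fun s => g s - h s) phi phi' 0 t t0.
rewrite !prim0 !subr0; apply => // s st; last first.
  exact/has_der_sub/pp.
have s0 : 0 <= s by move: st; rewrite in_itv => /andP[].
by apply: (@has_der_sub _ _ setT) => //; apply: has_derB; apply: has_der_prim.
Qed.

Lemma prim_le_cst (g h : R -> W) (M t : R) :
  continuous g -> continuous h -> 0 <= t ->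
  (forall s, s \in `[0, t] -> `|g s - h s| <= M) ->
  `|prim g t - prim h t| <= M * t.
Proof.
move=> cg ch t0 gh; rewrite -[M * t]subr0 -(mulr0 M).
apply: (prim_le (phi := fun s => M * s) (phi' := fun=> M)) => // s _.
exact: has_der_mull.
Qed.

(** Differentiation under the integral sign: uniform continuity of [dg] near the segment [[0, t]]
    times the point [x] makes the first-order error of [g s] uniform in [s], and [prim] multiplies
    it by at most [t]. *)
Lemma has_der_prim_param (g dg : R -> R -> W) (t x : R) :
  (forall y, continuous (g^~ y)) -> (forall y, continuous (dg^~ y)) -> 0 <= t ->
  continuous (fun z : R * R => dg z.1 z.2) ->
  (forall s y, has_der setT (g s) y (dg s y)) ->
  has_der setT (fun y => prim (g^~ y) t) x (prim (dg^~ x) t).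
Proof.
move=> cg cdg t0 jdg gdg e e0.
have t10 : 0 < t + 1 by rewrite ltr_pwDr.
have e'0 : 0 < e / (t + 1) by rewrite divr_gt0.
have [||d d0 Hd] := @compact_unif_cont R _ _ (`[0, t] `*` [set x])
    (fun z : R * R => dg z.1 z.2) _ _ _ e'0.
- by apply: compact_setX; [exact: segment_compact | exact: compact_set1].
- by move=> p _; exact: jdg.
exists d => // y _ yx.
(* [g'] is the affine approximation of [g s y]. Its primitive is identified by a mean value
   inequality with slope zero, which is how linearity of [prim] enters. *)
pose g' s := g s x + (y - x) *: dg s x.
have cg' : continuous g'.
  by move=> s; apply: cvgD; [exact: cg | apply: cvgZ; [exact: cvg_cst | exact: cdg]].
have e1 : forall s, 0 <= s ->
   prim g' s = prim (g^~ x) s + (y - x) *: prim (dg^~ x) s.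
  move=> s s0; apply/eqP; rewrite -subr_eq0 -normr_le0.
  have := @mean_value_le _ _ (fun s => prim g' s - (prim (g^~ x) s + (y - x) *: prim (dg^~ x) s))
    (fun s => g' s - (g s x + (y - x) *: dg s x)) (cst 0) (cst 0) 0 s s0.
  rewrite !prim0 scaler0 addr0 !subr0; apply => u.
  - rewrite in_itv => /andP[u0 _]; apply: (@has_der_sub _ _ setT) => //.
    apply: has_derB; first exact: has_der_prim.
    by apply: has_derD; [|apply: has_derZl]; exact: has_der_prim.
  - by move=> _; exact: has_der_cst.
  - by move=> _; rewrite subrr normr0.
have -> : prim (g^~ y) t - prim (g^~ x) t - (y - x) *: prim (dg^~ x) t =
   prim (g^~ y) t - prim g' t by rewrite e1 //; lmod_eq R.
have e'x0 : 0 <= e / (t + 1) * `|y - x| by rewrite mulr_ge0 // ltW.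
apply: le_trans (prim_le_cst (M := e / (t + 1) * `|y - x|) _ _ t0 _) _ => //; last first.
  rewrite mulrAC ler_wpM2r // mulrAC ler_pdivrMr // ler_pM2l //.
  by rewrite lerDl.
move=> s st.
have := @mean_value_segment _ _ (g s) (dg s) (dg s x) (e / (t + 1)) x y (gdg s).
rewrite /g' opprD addrA; apply => z zx; apply/ltW.
apply: (Hd (s, x) (s, z)) => //.
by rewrite pair_norm_lt /= subrr normr0 d0 /= (le_lt_trans zx).
Qed.

Lemma geometric_small (C e : R) : 0 < e -> exists k, C * 2^-1 ^+ k < e.
Proof.
move=> e0.
have g0 : (fun k => C * 2^-1 ^+ k) @ \oo --> (0 : R).
  rewrite -[X in _ --> X](mulr0 C).
  apply: cvgMr; apply: cvg_expr; rewrite ger0_norm //; lra.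
have /cvgrPdist_lt/(_ e e0)[N _ HN] := g0.
exists N; have := HN N (leqnn _); rewrite sub0r normrN.
exact: le_lt_trans (ler_norm _).
Qed.

(** The increments telescope to [2 * B] times a difference of powers of 1/2. The explicit rate is
    what later makes pointwise limits uniform in [(t, x)]. *)
Lemma geometric_limit (u : nat -> W) (B : R) :
  (forall k, `|u k.+1 - u k| <= B * 2^-1 ^+ k) ->
  exists l : W, forall k, `|l - u k| <= 2 * B * 2^-1 ^+ k.
Proof.
move=> uB.
have uk k m : `|u (k + m)%N - u k| <= 2 * B * (2^-1 ^+ k - 2^-1 ^+ (k + m)).
  elim: m => [|m IH]; first by rewrite addn0 !subrr normr0 mulr0.
  rewrite addnS (le_trans (ler_distD (u (k + m)%N) _ _)) //.
  apply: le_trans (lerD (uB _) IH) _; rewrite exprS.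
  by rewrite le_eqVlt; apply/orP; left; apply/eqP; field.
have B0 : 0 <= B by have := uB 0%N; rewrite expr0 mulr1; apply: le_trans.
have p0 k : 0 <= 2^-1 ^+ k :> R by rewrite exprn_ge0.
have uk' k m : `|u (k + m)%N - u k| <= 2 * B * 2^-1 ^+ k.
  apply: le_trans (uk k m) _; rewrite mulrBr gerBl.
  by rewrite !mulr_ge0.
have cu : cvgn u.
  apply/cauchy_cvgP/cauchy_exP => e e0.
  have [N HN] := geometric_small (2 * B) e0.
  exists (u N), N => // k /= Nk; rewrite -ball_normE /= distrC -(subnKC Nk).
  exact: le_lt_trans (uk' _ _) HN.
exists (limn u) => k; apply/ler_addgt0Pr => e e0.
have /cvgrPdist_lt/(_ e e0)[N _ HN] := cu.
have := HN (k + N)%N (leq_addl _ _) => h.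
apply: le_trans (ler_distD (u (k + N)%N) _ _) _.
by rewrite addrC lerD // ltW.
Qed.

(* Passing to the limit in the mean value inequality of the approximations. *)
Lemma has_der_limit (u du : nat -> R -> W) (v dv : R -> W) (B : R) (x : R) :
  (forall k y, has_der setT (u k) y (du k y)) ->
  (forall k y, `|v y - u k y| <= B * 2^-1 ^+ k) ->
  (forall k y, `|dv y - du k y| <= B * 2^-1 ^+ k) ->
  continuous dv -> has_der setT v x (dv x).
Proof.
move=> udu vu dvdu cdv e e0.
have e20 : 0 < e / 2 by rewrite divr_gt0.
have /cont_atP/(_ _ e20)[d d0 Hd] := cdv x.
exists d => // y _ yx.
apply/ler_addgt0Pr => e' e'0.
(* Two errors come from replacing [v] by [u k] at the endpoints, and three multiples of |y - x| from
   replacing [dv] by [du k]: two in [h1] and one at [x]. *)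
have [k Hk] := geometric_small (B * (2 + 3 * `|y - x|)) e'0.
set q := 2^-1 ^+ k in Hk *.
have h1 : `|u k y - u k x - (y - x) *: du k x| <= (e / 2 + 2 * (B * q)) * `|y - x|.
  apply: (mean_value_segment (g' := du k)) => // z zx.
  have -> : du k z - du k x = (dv z - dv x) - (dv z - du k z) + (dv x - du k x).
    by lmod_eq R.
  apply: le_trans (ler_normD _ _) _; apply: le_trans (lerD (ler_normB _ _) (lexx _)) _.
  rewrite -addrA mulrDl mul1r; apply: lerD; first exact/ltW/Hd/(le_lt_trans zx).
  by apply: lerD; exact: dvdu.
have -> : v y - v x - (y - x) *: dv x = (u k y - u k x - (y - x) *: du k x) +
   (v y - u k y) - (v x - u k x) - (y - x) *: (dv x - du k x) by lmod_eq R.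
apply: le_trans (ler_normB _ _) _; rewrite normrZ.
apply: le_trans (lerD (ler_normB _ _) (lexx _)) _.
apply: le_trans (lerD (lerD (ler_normD _ _) (lexx _)) (lexx _)) _.
have h4 : `|y - x| * `|dv x - du k x| <= `|y - x| * (B * q) by rewrite ler_wpM2l.
have := vu k x; have := vu k y; rewrite -/q => h2 h3.
have := normr_ge0 (y - x); move: h1 h2 h3 h4 Hk.
set yx' := `|y - x|; nra.
Qed.

End Primitive.

(** * Uniform remainder estimates for maps of class C^1 and C^2 *)

Section C1Maps.
Context {R : realType}.
Implicit Types (U V W : normedModType R).

(** Continuity is joint in base point and direction, so that compactness of a product of balls
    yields uniform estimates; [class_C1_map] derives it from the directionwise continuity of
    [class_C1]. *)
Definition C1_map V W (g : V -> W) (dg : V -> V -> W) : Prop :=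
  (forall p, frechet g p (dg p)) /\ continuous (fun z : V * V => dg z.1 z.2).

(** The form in which finite dimension is used; it passes to products. *)
Definition compact_balls V : Prop := forall M : R, compact [set v : V | `|v| <= M].

Lemma compact_balls_pair U V :
  compact_balls U -> compact_balls V -> compact_balls (U * V)%type.
Proof.
move=> cU cV M; rewrite (_ : [set _ | _] = [set u | `|u| <= M] `*` [set v | `|v| <= M]).
  exact: compact_setX.
by apply/seteqP; split=> z /=; rewrite pair_norm_le => /andP.
Qed.

Lemma compact_balls_rV n : compact_balls 'rV[R]_n.
Proof.
move=> M; apply: bounded_closed_compact.
  exists M; split; first exact: num_real.
  by move=> x Mx v /= vM; apply: le_trans vM (ltW Mx).
rewrite (_ : [set _ | _] = Num.norm @^-1` [set x | x <= M]) //.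
by apply: closed_comp; [move=> x _; exact: norm_continuous | exact: closed_le].
Qed.

(** By homogeneity in [v] the bound reduces to the unit ball, and [dg] is bounded on a compact
    product of balls. *)
Lemma C1_map_lip V W (g : V -> W) dg : compact_balls V -> C1_map g dg ->
  forall M : R, exists2 K : R, 0 < K &
    forall u v, `|u| <= M -> `|dg u v| <= K * `|v|.
Proof.
move=> cV [gf gc] M.
have [K K0 HK] := compact_bound (compact_setX (cV M) (cV 1))
  (continuous_subspaceT gc).
exists K => // u v uM; have [_ dZ _ _] := gf u.
have [->|v0] := eqVneq v 0.
  by rewrite (frechet0 (gf u)) !normr0 mulr0.
have v1 : `| `|v|^-1 *: v| <= 1.
  by rewrite normrZ normfV normr_id mulVf // normr_eq0.
rewrite -[v in dg u v](scalerKV (_ : `|v| != 0)) ?normr_eq0 // dZ normrZ normr_id.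
by rewrite mulrC ler_pM2r ?normr_gt0 //; apply: (HK (u, _)).
Qed.

Lemma C1_map_unif V W (g : V -> W) dg : compact_balls V -> C1_map g dg ->
  forall M e : R, 0 < e -> exists2 d : R, 0 < d &
    forall u u' v, `|u| <= M -> `|u' - u| < d -> `|dg u' v - dg u v| <= e * `|v|.
Proof.
move=> cV [gf gc] M e e0.
have [d d0 Hd] := compact_unif_cont (compact_setX (cV M) (cV 1)) (fun p _ => gc p) e0.
exists d => // u u' v uM u'u; have [_ dZ _ _] := gf u; have [_ dZ' _ _] := gf u'.
have [->|v0] := eqVneq v 0.
  by rewrite !(frechet0 (gf _)) subrr !normr0 mulr0.
have v1 : `| `|v|^-1 *: v| <= 1.
  by rewrite normrZ normfV normr_id mulVf // normr_eq0.
have ve : v = `|v| *: (`|v|^-1 *: v) by rewrite scalerKV // normr_eq0.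
rewrite {1 2}ve dZ dZ' -scalerBr normrZ normr_id.
rewrite mulrC ler_pM2r ?normr_gt0 //; apply/ltW.
apply: (Hd (u, `|v|^-1 *: v) (u', `|v|^-1 *: v)) => //.
by rewrite pair_norm_lt /= u'u subrr normr0.
Qed.

(** Near 0 the remainder of a C^1 map is Lipschitz with a constant as small as desired; this
    provides the small constant [eta]. *)
Lemma C1_map_remainder V W (g : V -> W) dg : compact_balls V -> C1_map g dg ->
  forall M e : R, 0 < e -> exists2 r : R, 0 < r &
    forall u h k, `|u| <= M -> `|h| <= r -> `|k| <= r ->
      `|g (u + h) - g (u + k) - dg u (h - k)| <= e * `|h - k|.
Proof.
move=> cV gdg M e e0; have [d d0 Hd] := C1_map_unif cV gdg M e0.
(* The mean value inequality visits [k + s *: (h - k)] for all [s] with |s| at most 1, negative ones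
   included; these points have norm at most d/4 + d/2 < d. *)
exists (d / 4) => [|u h k uM hd kd]; first by rewrite divr_gt0.
have [gf _] := gdg.
have := @mean_value_segment _ _ (fun s => g (u + (k + s *: (h - k))))
   (fun s => dg (u + (k + s *: (h - k))) (h - k)) (dg u (h - k)) (e * `|h - k|) 0 1.
rewrite !subr0 scale1r scale0r normr1 mulr1 addr0 !scale1r.
rewrite (_ : u + (k + (h - k)) = u + h); last by lmod_eq R.
apply => [s|s s1].
  apply: has_der_comp; first exact: gf.
  have := has_derD (has_der_cst setT u s) (has_derD (has_der_cst setT k s)
    (has_der_scale setT (h - k) s)).
  by rewrite !add0r.
apply: Hd => //; rewrite addrC addKr; rewrite subr0 in s1.
apply: le_lt_trans (ler_normD _ _) _; rewrite normrZ.
have hk := ler_normB h k.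
have : `|s| * `|h - k| <= 1 * (d / 2).
  by apply: ler_pM => //; apply: le_trans hk _; lra.
by move: hd kd; lra.
Qed.

Lemma C1_map_sum V W (I : finType) (g : I -> V -> W) dg :
  (forall i, C1_map (g i) (dg i)) ->
  C1_map (fun v => \sum_i g i v) (fun u v => \sum_i dg i u v).
Proof.
move=> gdg; rewrite (_ : (fun v => _) = \sum_i g i); last first.
  by apply/funext => v; rewrite fct_sumE.
rewrite (_ : (fun u v => _) = \sum_i dg i); last first.
  by apply/funext => u; apply/funext => v; rewrite fct_sumE fct_sumE.
apply: (big_ind2 (fun (f : V -> W) (u : V -> V -> W) => C1_map f u)) => [|f u h w|i _];
  last exact: gdg.
- split; last exact: cst_continuous.
  move=> p; split.
  + by move=> x y; rewrite subrr.
  + by move=> c x; rewrite scaler0.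
  + by exists 1 => // v; rewrite normr0 mul1r.
  + by move=> e e0; exists 1 => // q _; rewrite !subrr normr0 mulr_ge0 // ltW.
- move=> [fu uc] [hw wc]; split; last by move=> z; apply: cvgD; [exact: uc|exact: wc].
  move=> p; have [uB uZ [k k0 Hk] ua] := fu p; have [wB wZ [l l0 Hl] wa] := hw p.
  split.
  + by move=> x y; rewrite !fctE uB wB; lmod_eq R.
  + by move=> c x; rewrite !fctE uZ wZ; lmod_eq R.
  + exists (k + l); first by rewrite addr_gt0.
    by move=> v; rewrite mulrDl !fctE (le_trans (ler_normD _ _)) // lerD.
  + move=> e e0; have e20 : 0 < e / 2 by rewrite divr_gt0.
    have [d1 d10 H1] := ua _ e20; have [d2 d20 H2] := wa _ e20.
    exists (Num.min d1 d2); first by rewrite lt_min d10.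
    move=> q; rewrite lt_min => /andP[/H1 h1 /H2 h2]; rewrite !fctE.
    rewrite [X in `|X|](_ : _ = (f q - f p - u p (q - p)) + (h q - h p - w p (q - p))).
      by rewrite (splitr e) mulrDl (le_trans (ler_normD _ _)) // lerD.
    by lmod_eq R.
Qed.

Lemma frechet_cont V W (g : V -> W) p l : frechet g p l -> {for p, continuous g}.
Proof.
move=> [_ _ [k k0 Hk] gl]; apply/cont_atP => e e0.
have [d d0 Hd] := gl 1 ltr01.
have k1 : 0 < k + 1 by rewrite addr_gt0.
exists (Num.min d (e / (k + 1))); first by rewrite lt_min d0 divr_gt0.
move=> q; rewrite lt_min ltr_pdivlMr // => /andP[/Hd h1 h2].
rewrite -[g q - g p](subrK (l (q - p))).
apply: le_lt_trans (ler_normD _ _) _; apply: le_lt_trans (lerD h1 (Hk _)) _.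
by move: h2; rewrite mul1r mulrDr mulr1 addrC [k * _]mulrC.
Qed.

(** Product rule for one term of the tangent map expanded in coordinates: [c] reads a coordinate of
    the direction, [g] will be the differential along a basis vector. *)
Lemma C1_map_coord U V W (c : V -> R) (g : U -> W) dg :
  (forall x y, c (x - y) = c x - c y) -> (forall a x, c (a *: x) = a * c x) ->
  (forall x, `|c x| <= `|x|) -> C1_map g dg ->
  C1_map (fun z : U * V => c z.2 *: g z.1)
    (fun z h => c z.2 *: dg z.1 h.1 + c h.2 *: g z.1).
Proof.
move=> cB cZ cn [gf gc].
have cc : continuous c.
  move=> p; apply/cont_atP => e e0; exists e => // q; rewrite -cB.
  exact: le_lt_trans.
have gcont : continuous g by move=> p; apply: frechet_cont (gf p).
split; last first.
  move=> [[u v] [h k]] /=; apply: cvgD; apply: cvgZ.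
  - apply: (@continuous_comp _ _ _ (fun z : (U * V) * (U * V) => z.1.2) c); last exact: cc.
    by apply: (@continuous_comp _ _ _ fst snd); [exact: cvg_fst|exact: cvg_snd].
  - apply: (@continuous_comp _ _ _ (fun z : (U * V) * (U * V) => (z.1.1, z.2.1))
      (fun z => dg z.1 z.2)); last exact: gc.
    apply: cvg_pair.
      by apply: (@continuous_comp _ _ _ fst fst); [exact: cvg_fst|exact: cvg_fst].
    by apply: (@continuous_comp _ _ _ snd fst); [exact: cvg_snd|exact: cvg_fst].
  - apply: (@continuous_comp _ _ _ (fun z : (U * V) * (U * V) => z.2.2) c); last exact: cc.
    by apply: (@continuous_comp _ _ _ snd snd); [exact: cvg_snd|exact: cvg_snd].
  - apply: (@continuous_comp _ _ _ (fun z : (U * V) * (U * V) => z.1.1) g); last exact: gcont.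
    by apply: (@continuous_comp _ _ _ fst fst); [exact: cvg_fst|exact: cvg_fst].
move=> [u v]; have [lB lZ [k k0 Hk] gl] := gf u; split=> /=.
- by move=> [x1 x2] [y1 y2] /=; rewrite lB cB; lmod_eq R.
- by move=> a [x1 x2] /=; rewrite lZ cZ; lmod_eq R.
- exists (`|v| * k + `|g u| + 1).
    by rewrite ltr_pwDr // addr_ge0 // mulr_ge0 // ltW.
  move=> [h1 h2] /=.
  have [H1 H2] : `|h1| <= `|(h1, h2)| /\ `|h2| <= `|(h1, h2)|.
    by rewrite prod_normE /= !le_max !lexx orbT.
  apply: le_trans (ler_normD _ _) _; rewrite !normrZ.
  have q1 : `|c v| * `|dg u h1| <= `|v| * k * `|(h1, h2)|.
    rewrite -mulrA ler_pM // (le_trans (Hk _)) // ler_wpM2l // ltW //.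
  have q2 : `|c h2| * `|g u| <= `|g u| * `|(h1, h2)|.
    by rewrite mulrC ler_wpM2l // (le_trans (cn _)).
  have := normr_ge0 (h1, h2); lra.
- move=> e e0; have m0 : 0 < `|v| + 1 by rewrite ltr_pwDr.
  have e20 : 0 < e / 2 by rewrite divr_gt0.
  have [d1 d10 H1] := gl (e / 2 / (`|v| + 1)) (divr_gt0 e20 m0).
  have /cont_atP/(_ _ e20)[d2 d20 H2] := gcont u.
  exists (Num.min d1 d2); first by rewrite lt_min d10.
  move=> [u' v'] /=; rewrite lt_min !pair_norm_lt /=.
  move=> /andP[/andP[/H1 h1 _] /andP[/H2 h2 _]].
  have -> : c v' *: g u' - c v *: g u - (c v *: dg u (u' - u) + c (v' - v) *: g u) =
    c v *: (g u' - g u - dg u (u' - u)) + c (v' - v) *: (g u' - g u).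
    by rewrite cB; lmod_eq R.
  have [Q1 Q2] : `|u' - u| <= `|(u', v') - (u, v)| /\ `|v' - v| <= `|(u', v') - (u, v)|.
    by rewrite prod_normE /= !le_max !lexx orbT.
  apply: le_trans (ler_normD _ _) _; rewrite !normrZ (splitr e) mulrDl lerD //.
    have -> : e / 2 * `|(u', v') - (u, v)| =
      (`|v| + 1) * (e / 2 / (`|v| + 1) * `|(u', v') - (u, v)|).
      by field; rewrite gt_eqF.
    rewrite ler_pM //; first by rewrite (le_trans (cn _)) // lerDl.
    by rewrite (le_trans h1) // ler_wpM2l // ltW // divr_gt0.
  by rewrite mulrC ler_pM // ?(ltW h2) // (le_trans (cn _)).
Qed.

End C1Maps.

(** * The tangent map and the symmetry of the second derivative *)

Section TangentMap.
Context {R : realType}.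
Implicit Types (U V W : normedModType R).

(** A basis with its dual coordinates. The last clause holds in the cases at hand because the norms
    of row vectors and of pairs are sup norms. *)
Definition coordinates V (I : finType) (b : I -> V) (c : I -> V -> R) : Prop :=
  [/\ forall v, v = \sum_i c i v *: b i,
      forall i x y, c i (x - y) = c i x - c i y,
      forall i a x, c i (a *: x) = a * c i x &
      forall i x, `|c i x| <= `|x|].

Lemma mx_coord_le n (v : 'rV[R]_n) j : `|v 0 j| <= `|v|.
Proof.
rewrite [leRHS]mx_normrE; exact: (le_bigmax _ (fun ij => `|v ij.1 ij.2|) (0, j)).
Qed.

Lemma coordinates_rV n :
  coordinates (fun j => 'e_j : 'rV[R]_n) (fun j (v : 'rV[R]_n) => v 0 j).
Proof.
split=> [v|i x y|i a x|i x].
- exact: row_sum_delta.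
- by rewrite !mxE.
- by rewrite !mxE.
- exact: mx_coord_le.
Qed.

Lemma coordinates_pair U V (I J : finType) (b : I -> U) c (b' : J -> V) c' :
  coordinates b c -> coordinates b' c' ->
  coordinates (fun k : I + J => match k with inl i => (b i, 0) | inr j => (0, b' j) end)
    (fun (k : I + J) (z : U * V) => match k with inl i => c i z.1 | inr j => c' j z.2 end).
Proof.
move=> [bE cB cZ cn] [bE' cB' cZ' cn']; split=> [[u v]|[i|j] [? ?] [? ?]|[i|j] a [? ?]|[i|j] x] //=.
- rewrite big_sumType /=.
  rewrite (eq_bigr (fun i => (c i u *: b i, 0))); last first.
    by move=> i _; congr pair; rewrite scaler0.
  rewrite [X in _ = _ + X](eq_bigr (fun j => (0, c' j v *: b' j))); last first.
    by move=> i _; congr pair; rewrite scaler0.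
  have -> : \sum_i (c i u *: b i, 0 : V) = (u, 0).
    rewrite [in RHS](bE u); elim/big_rec2 : _ => // i y1 y2 _ ->.
    by rewrite /GRing.add /= /add_pair /= addr0.
  have -> : \sum_j (0 : U, c' j v *: b' j) = (0, v).
    rewrite [in RHS](bE' v); elim/big_rec2 : _ => // i y1 y2 _ ->.
    by rewrite /GRing.add /= /add_pair /= addr0.
  by rewrite /GRing.add /= /add_pair /= addr0 add0r.
- by rewrite prod_normE (le_trans (cn _ _)) // le_max lexx.
- by rewrite prod_normE (le_trans (cn' _ _)) // le_max lexx orbT.
Qed.

Lemma diff_coordinates V W (I : finType) (b : I -> V) c (f : V -> W) p v :
  coordinates b c -> 'd f p v = \sum_i c i v *: 'd f p (b i).
Proof.
move=> [bE _ _ _]; rewrite [in LHS](bE v) linear_sum.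
by apply: eq_bigr => i _; rewrite linearZ.
Qed.

(** Expanding the direction in coordinates gives a finite sum of continuous scalar factors times
    ['d f p (b i)], so continuity in each fixed direction becomes joint. *)
Lemma class_C1_map V W (I : finType) (b : I -> V) c (f : V -> W) :
  coordinates b c -> class_C1 f -> C1_map f (fun p => 'd f p).
Proof.
move=> bc [df cdf]; have [_ cB cZ cn] := bc; split; first by move=> p; apply: frechet_diff.
have -> : (fun z : V * V => 'd f (z.1) z.2) =
    fun z => \sum_i c i z.2 *: 'd f (z.1) (b i).
  by apply/funext => z; exact: diff_coordinates.
apply: continuous_sum => i z; apply: cvgZ.
  apply: (@continuous_comp _ _ _ snd (c i)); first exact: cvg_snd.
  apply/cont_atP => e e0; exists e => // q; rewrite -cB.
  exact: le_lt_trans.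
apply: (@continuous_comp _ _ _ fst (fun p => 'd f p (b i))); first exact: cvg_fst.
exact: cdf.
Qed.

(** [dPhi] is the product rule applied to the expansion of ['d f u v] in the coordinates of [v]. The
    second clause reflects linearity in [v]; it later splits [dPhi] into a second-order part and
    ['d f]. *)
Lemma class_C2_tangent V W (I : finType) (b : I -> V) c (f : V -> W) :
  coordinates b c -> class_C2 f -> exists dPhi,
    C1_map (fun z : V * V => 'd f (z.1) z.2) dPhi /\
    forall u v k, dPhi (u, v) (0, k) = 'd f u k.
Proof.
move=> bc [_ C2f]; have [_ cB cZ cn] := bc.
exists (fun z h => \sum_i (c i z.2 *: 'd (fun p => 'd f p (b i)) (z.1) h.1 +
                    c i h.2 *: 'd f (z.1) (b i))); split.
  have -> : (fun z : V * V => 'd f (z.1) z.2) =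
      fun z => \sum_i c i z.2 *: 'd f (z.1) (b i).
    by apply/funext => z; exact: diff_coordinates.
  apply: (@C1_map_sum _ _ _ I (fun i (z : V * V) => c i z.2 *: 'd f (z.1) (b i))
    (fun i (z h : V * V) => c i z.2 *: 'd (fun p => 'd f p (b i)) (z.1) h.1 +
                    c i h.2 *: 'd f (z.1) (b i))) => i.
  apply: (@C1_map_coord _ V V W (c i) (fun p => 'd f p (b i))
    (fun p => 'd (fun p => 'd f p (b i)) p)); [exact: cB|exact: cZ|exact: cn|].
  exact: (class_C1_map bc).
move=> u v k; apply: (etrans _ (esym (diff_coordinates f u k bc))).
apply: eq_bigr => i _; have [/(_ u)/frechet0 d0 _] := class_C1_map bc (C2f (b i)).
by rewrite [X in c i _ *: X]d0 scaler0 add0r.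
Qed.

(* Schwarz: [f (u + s h + s v) - f (u + s h) - f (u + s v) + f u] is symmetric in
   [h] and [v] and equal to [s ^+ 2 *: D2 f u h v] up to a small multiple of
   [s ^+ 2]. *)
Lemma second_diff_sym V W (f : V -> W) df (dPhi : V * V -> V * V -> W) u h v :
  compact_balls V -> C1_map f df ->
  C1_map (fun z : V * V => df z.1 z.2) dPhi ->
  dPhi (u, v) (h, 0) = dPhi (u, h) (v, 0).
Proof.
move=> cV [ff _] dP.
have [Pf _] := dP.
(* Mean value inequality in [t] for [f (u + s *: x + t *: y) - f (u + t *: y)]: the derivative is an
   increment of the tangent map at [(u, y)] in the direction [(s *: x, 0)], known up to [e * s], and
   the interval has length [s]. *)
have half (x y : V) e : 0 < e -> exists2 r : R, 0 < r & forall s, 0 <= s -> s <= r ->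
    `|f (u + s *: x + s *: y) - f (u + s *: y) - (f (u + s *: x) - f u)
      - (s * s) *: dPhi (u, y) (x, 0)| <= e * s * s.
  move=> e0; have x1 : 0 < `|x| + 1 by rewrite ltr_pwDr.
  have y1 : 0 < `|y| + 1 by rewrite ltr_pwDr.
  have [r r0 Hr] := C1_map_remainder (compact_balls_pair cV cV) dP
    `|(u, y)| (divr_gt0 e0 x1).
  exists (r / (`|x| + 1 + (`|y| + 1))); first exact: divr_gt0 r0 (addr_gt0 x1 y1).
  move=> s s0; rewrite (ler_pdivlMr _ _ (addr_gt0 x1 y1)) => sr.
  have := @mean_value_segment _ _ (fun t => f (u + s *: x + t *: y) - f (u + t *: y))
    (fun t => df (u + s *: x + t *: y) y - df (u + t *: y) y)
    (s *: dPhi (u, y) (x, 0)) (e * s) 0 s.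
  rewrite !scale0r !addr0 subr0 [`|s|]ger0_norm // scalerA; apply.
    move=> t; apply: has_derB; apply: has_der_comp; try exact: ff.
    - have := has_derD (has_der_cst setT (u + s *: x) t) (has_der_scale setT y t).
      by rewrite add0r.
    - have := has_derD (has_der_cst setT u t) (has_der_scale setT y t).
      by rewrite add0r.
  move=> t; rewrite subr0 => ts.
  have sx : s * `|x| <= r.
    by apply: le_trans sr; rewrite ler_wpM2l //; have := normr_ge0 y; lra.
  have tyr : `|t| * `|y| <= s * `|y| by rewrite ler_wpM2r.
  have sxy : s * `|x| + s * `|y| <= r.
    by apply: le_trans sr; rewrite -mulrDr ler_wpM2l //; lra.
  have := Hr (u, y) (s *: x + t *: y, 0) (t *: y, 0) (lexx _).
  have -> : (u, y) + (s *: x + t *: y, 0) = (u + s *: x + t *: y, y).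
    by rewrite /GRing.add /= /add_pair /= addrA addr0.
  have -> : (u, y) + (t *: y, 0) = (u + t *: y, y).
    by rewrite /GRing.add /= /add_pair /= addr0.
  have -> : (s *: x + t *: y, 0) - (t *: y, 0) = s *: (x, 0) :> V * V.
    by rewrite -[RHS]/(s *: x, s *: 0) -[LHS]/(s *: x + t *: y - t *: y, 0 - 0) addrK subr0 scaler0.
  have [_ dZ _ _] := Pf (u, y).
  rewrite dZ !pair_norm_le /= normr0 (ltW r0) !andbT => {}Hr.
  apply: le_trans (Hr _ _) _.
  - rewrite (le_trans (ler_normD _ _)) // !normrZ (ger0_norm s0).
    by apply: le_trans sxy; rewrite lerD2l.
  - rewrite normrZ (le_trans tyr) //; apply: le_trans sxy; rewrite lerDr.
    by rewrite mulr_ge0.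
  rewrite normrZ (ger0_norm s0) prod_normE /= normr0.
  rewrite (_ : Num.max _ _ = `|x|); last by apply/max_idPl.
  rewrite mulrA ![_ * s]mulrC -mulrA ler_wpM2l // mulrAC ler_pdivrMr //.
  by rewrite ler_pM2l // lerDl.
apply/eqP; rewrite -subr_eq0 -normr_le0; apply/ler_addgt0Pr => e e0; rewrite add0r.
have e20 : 0 < e / 2 by rewrite divr_gt0.
have [r r0 Hr] := half h v _ e20; have [r' r'0 Hr'] := half v h _ e20.
(* The two expansions of the same second difference, with [h] and [v] exchanged, are compared at one
   [s] and divided by [s * s]. *)
pose s := Num.min r r'.
have s0 : 0 < s by rewrite lt_min r0.
have := Hr s (ltW s0); have := Hr' s (ltW s0).
rewrite !ge_min !lexx orbT /= => /(_ isT) h1 /(_ isT) h2.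
have ss : 0 < s * s by rewrite mulr_gt0.
rewrite -(ler_pM2l ss) -[X in X * `|_|]gtr0_norm // -normrZ.
set a := dPhi (u, v) _ in h2 *; set b' := dPhi (u, h) _ in h1 *.
have -> : (s * s) *: (a - b') =
  (f (u + s *: v + s *: h) - f (u + s *: h) - (f (u + s *: v) - f u) - (s * s) *: b')
  - (f (u + s *: h + s *: v) - f (u + s *: v) - (f (u + s *: h) - f u) - (s * s) *: a).
  have -> : u + s *: v + s *: h = u + s *: h + s *: v by rewrite addrAC.
  by lmod_eq R.
apply: le_trans (ler_normB _ _) _; apply: le_trans (lerD h1 h2) _.
by rewrite le_eqVlt; apply/orP; left; apply/eqP; field.
Qed.

End TangentMap.

(** * Picard iteration for the two-point problem *)

Section Clamp.
Context {R : realType}.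
Implicit Types T t : R.

(** Freezing time outside [[0, T]] extends all functions to the whole plane, where continuity is
    unrestricted, and keeps the upper limit of [prim] nonnegative. *)
Definition clamp T t : R := Num.max 0 (Num.min T t).

Lemma clamp_ge0 T t : 0 <= clamp T t.
Proof. by rewrite le_max lexx. Qed.

Lemma clamp_le T t : 0 <= T -> clamp T t <= T.
Proof. by move=> T0; rewrite ge_max T0 /= ge_min lexx. Qed.

Lemma clamp_id T t : t \in `[0, T] -> clamp T t = t.
Proof.
rewrite in_itv /= => /andP[t0 tT].
by rewrite /clamp (min_idPr tT) (max_idPr t0).
Qed.

Lemma clamp_in T t : 0 <= T -> clamp T t \in `[0, T].
Proof. by move=> T0; rewrite in_itv /= clamp_ge0 clamp_le. Qed.

Lemma continuous_clamp T : continuous (clamp T).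
Proof.
move=> t; apply: (@continuous_max _ _ (cst 0) (fun t => Num.min T t)); first exact: cvg_cst.
by apply: (@continuous_min _ _ (cst T) id); [exact: cvg_cst | exact: cvg_id].
Qed.

End Clamp.

Section JointContinuity.
Context {R : realType} {W : normedModType R}.

Definition joint_cont (g : R -> R -> W) := continuous (fun z : R * R => g z.1 z.2).

Lemma joint_cont_l g x : joint_cont g -> continuous (g^~ x).
Proof.
move=> cg t; apply: (@continuous_comp _ _ _ (fun t => (t, x))
  (fun z : R * R => g z.1 z.2)); last exact: cg.
by apply: continuous_at_pair; [exact: cvg_id | exact: cvg_cst].
Qed.

Lemma joint_cont_r g t : joint_cont g -> continuous (g t).
Proof.
move=> cg x; apply: (@continuous_comp _ _ _ (fun x => (t, x))
  (fun z : R * R => g z.1 z.2)); last exact: cg.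
by apply: continuous_at_pair; [exact: cvg_cst | exact: cvg_id].
Qed.

End JointContinuity.

Section PrimitiveContinuity.
Context {R : realType} {n : nat}.
Local Notation W := 'rV[R]_n.

Lemma joint_cont_prim T (g : R -> R -> W) : 0 <= T -> joint_cont g ->
  joint_cont (fun t x => prim (g^~ x) (clamp T t)).
Proof.
move=> T0 cg [t x] /=; apply/cont_atP => e e0 /=.
have T10 : 0 < T + 1 by rewrite ltr_pwDr.
have e20 : 0 < e / 2 by rewrite divr_gt0.
have [d d0 Hd] := compact_unif_cont
  (compact_setX (segment_compact (a := 0) (b := T)) (compact_set1 (x := x)))
  (fun p _ => cg p) (divr_gt0 e20 T10).
have : {for t, continuous (prim (g^~ x) \o clamp T)}.
  apply: continuous_comp; first exact: continuous_clamp.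
  by apply: continuous_has_der; apply: has_der_prim; [exact: joint_cont_l|exact: clamp_ge0].
move=> /cont_atP/(_ _ e20)[d' d'0 Hd'].
exists (Num.min d d'); first by rewrite lt_min d0.
move=> [t' x']; rewrite pair_norm_lt /= !lt_min => /andP[/andP[_ tt] /andP[xx _]].
apply: le_lt_trans (ler_distD (prim (g^~ x) (clamp T t')) _ _) _.
rewrite (splitr e); apply: ler_ltD; last exact: Hd'.
apply: le_trans (prim_le_cst (M := e / 2 / (T + 1)) _ _ (clamp_ge0 _ _) _) _.
- exact: joint_cont_l.
- exact: joint_cont_l.
- move=> s; rewrite in_itv /= => /andP[s0 sT]; apply/ltW.
  apply: (Hd (s, x) (s, x')).
    by split=> //=; rewrite in_itv /= s0 (le_trans sT) // clamp_le.
  by rewrite pair_norm_lt /= subrr normr0 d0.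
rewrite mulrAC ler_pdivrMr // ler_wpM2l //; first exact: ltW.
by apply: le_trans (clamp_le _ T0) _; rewrite lerDl.
Qed.

Lemma joint_cont_limit (u : nat -> R -> R -> W) (v : R -> R -> W) (B : R) :
  (forall k, joint_cont (u k)) ->
  (forall k t x, `|v t x - u k t x| <= B * 2^-1 ^+ k) -> joint_cont v.
Proof.
move=> cu vu z; apply/cont_atP => e e0.
have e30 : 0 < e / 3 by rewrite divr_gt0.
have [k Hk] := geometric_small B e30.
have /cont_atP/(_ _ e30)[d d0 Hd] := cu k z.
exists d => // z' /Hd h.
have h1 := le_lt_trans (vu k z.1 z.2) Hk.
have h2 := le_lt_trans (vu k z'.1 z'.2) Hk.
have h3 := ler_distD (u k z'.1 z'.2) (v z'.1 z'.2) (v z.1 z.2).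
have h4 := ler_distD (u k z.1 z.2) (u k z'.1 z'.2) (v z.1 z.2).
move: h h1 h2 h3 h4; rewrite [`|u k z.1 _ - _|]distrC => *; lra.
Qed.

End PrimitiveContinuity.

Section BoundaryValuePicard.
Context {R : realType} {n : nat} (T L K eta r : R).
Local Notation W := 'rV[R]_n.
Context (H1 : R -> R -> W -> W -> W) (H2 : R -> R -> W -> W -> W -> W -> W).
Local Notation expT := (expR (4 * K * T)).

(* [H2] is the derivative in [x] of [x |-> H1 t x (w x) (c x)] when [p] and [d] are
   those of [w] and [c]. *)
Record admissible_rhs : Prop := AdmissibleRhs {
  rhs_T : 0 <= T;
  rhs_K : 0 < K;
  rhs_eta : 0 <= eta <= 1;
  (* The value [c] at time [T] is not damped by the weight [expR (4 * K * t)]. *)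
  rhs_small : eta * T * expT <= 4^-1;
  rhs_cont1 : forall w c, joint_cont w -> continuous c ->
    joint_cont (fun t x => H1 t x (w t x) (c x));
  rhs_cont2 : forall w p c d, joint_cont w -> joint_cont p ->
    continuous c -> continuous d ->
    joint_cont (fun t x => H2 t x (w t x) (p t x) (c x) (d x));
  rhs_lip1 : forall t x w w' c c' (a b : R),
    `|w| <= r -> `|w'| <= r -> `|c| <= r -> `|c'| <= r ->
    `|w - w'| <= a -> `|c - c'| <= b ->
    `|H1 t x w c - H1 t x w' c'| <= K * a + eta * b;
  rhs_lip2 : forall t x w w' p p' c c' d d' (a b : R),
    `|w| <= r -> `|w'| <= r -> `|p| <= r -> `|p'| <= r ->
    `|c| <= r -> `|c'| <= r -> `|d| <= r -> `|d'| <= r ->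
    `|w - w'| <= a -> `|p - p'| <= a -> `|c - c'| <= b -> `|d - d'| <= b ->
    `|H2 t x w p c d - H2 t x w' p' c' d'| <= K * a + eta * b;
  rhs01 : forall t x, H1 t x 0 0 = 0;
  rhs02 : forall t x, H2 t x 0 0 0 0 = 0;
  rhs_der : forall t x w p c d, has_der setT w x p -> has_der setT c x d ->
    has_der setT (fun y => H1 t y (w y) (c y)) x (H2 t x (w x) p (c x) d);
  rhs_per1 : forall t x, H1 t (x + L) = H1 t x;
  rhs_per2 : forall t x, H2 t (x + L) = H2 t x }.

Context (Hrhs : admissible_rhs).
Context (d0 dd0 d1 dd1 : R -> W) (mu : R).
Context (d0_der : forall x, has_der setT d0 x (dd0 x))
  (d1_der : forall x, has_der setT d1 x (dd1 x))
  (dd0_cont : continuous dd0) (dd1_cont : continuous dd1).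
Context (d0_mu : forall x, `|d0 x| <= mu) (dd0_mu : forall x, `|dd0 x| <= mu)
  (d1_mu : forall x, `|d1 x| <= mu) (dd1_mu : forall x, `|dd1 x| <= mu).
Context (d0_per : forall x, d0 (x + L) = d0 x) (dd0_per : forall x, dd0 (x + L) = dd0 x)
  (d1_per : forall x, d1 (x + L) = d1 x) (dd1_per : forall x, dd1 (x + L) = dd1 x).

(** [B] bounds the first iterates. [C] bounds the sum of all increments: the weight is replaced by
    its maximum [expT], and the geometric series sums to 2. *)
Let B : R := mu * (1 + T).
Let C : R := 2 * B * expT.

Context (mu_r : mu + C <= r).

(** [d1 x - w T x] stands for [c]: the unknown amplitude is eliminated, and each iterate uses the
    terminal value of the preceding one. *)
Let step1 (w : R -> R -> W) t x :=
  d0 x + prim (fun s => H1 s x (w s x) (d1 x - w T x)) (clamp T t).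
Let step2 (w p : R -> R -> W) t x :=
  dd0 x + prim (fun s => H2 s x (w s x) (p s x) (d1 x - w T x) (dd1 x - p T x))
    (clamp T t).

Context (w_ p_ : nat -> R -> R -> W).
Context (w0 : w_ 0%N = fun=> fun=> 0) (wS : forall k, w_ k.+1 = step1 (w_ k)).
Context (p0 : p_ 0%N = fun=> fun=> 0) (pS : forall k, p_ k.+1 = step2 (w_ k) (p_ k)).

Let T0 : 0 <= T := rhs_T Hrhs.
Let K0 : 0 < K := rhs_K Hrhs.
Let mu0 : 0 <= mu := le_trans (normr_ge0 (d0 0)) (d0_mu 0).
Let eta0 : 0 <= eta. Proof. by case/andP: (rhs_eta Hrhs). Qed.
Let eta1 : eta <= 1. Proof. by case/andP: (rhs_eta Hrhs). Qed.
Let B0 : 0 <= B. Proof. by rewrite mulr_ge0 // addr_ge0. Qed.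
Let E0 : 0 < expT. Proof. exact: expR_gt0. Qed.
Let C0 : 0 <= C. Proof. exact: mulr_ge0 (mulr_ge0 (ler0n _ 2) B0) (ltW E0). Qed.

Let d0_cont : continuous d0. Proof. by move=> x; apply: continuous_has_der. Qed.
Let d1_cont : continuous d1. Proof. by move=> x; apply: continuous_has_der. Qed.

Let end_cont (d : R -> W) w : continuous d -> joint_cont w ->
  continuous (fun x => d x - w T x).
Proof. by move=> cd cw x; apply: cvgB; [exact: cd|exact: joint_cont_r]. Qed.

Let rhs1_cont w : joint_cont w ->
  joint_cont (fun s x => H1 s x (w s x) (d1 x - w T x)).
Proof. by move=> cw; apply: (rhs_cont1 Hrhs) => //; exact: end_cont. Qed.

Let rhs2_cont w p : joint_cont w -> joint_cont p ->
  joint_cont (fun s x => H2 s x (w s x) (p s x) (d1 x - w T x) (dd1 x - p T x)).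
Proof. by move=> cw cp; apply: (rhs_cont2 Hrhs) => //; exact: end_cont. Qed.

Let step1_cont w : joint_cont w -> joint_cont (step1 w).
Proof.
move=> cw z; apply: cvgD; last exact: (joint_cont_prim T0 (rhs1_cont cw)).
by apply: (@continuous_comp _ _ _ snd d0); [exact: cvg_snd|exact: d0_cont].
Qed.

Let step2_cont w p : joint_cont w -> joint_cont p -> joint_cont (step2 w p).
Proof.
move=> cw cp z; apply: cvgD; last exact: (joint_cont_prim T0 (rhs2_cont cw cp)).
by apply: (@continuous_comp _ _ _ snd dd0); [exact: cvg_snd|exact: dd0_cont].
Qed.

Let approx_cont k : joint_cont (w_ k) /\ joint_cont (p_ k).
Proof.
elim: k => [|k [cw cp]].
  by rewrite w0 p0; split; exact: cst_continuous.
by rewrite wS pS; split; [exact: step1_cont|exact: step2_cont].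
Qed.

(** By differentiation under the integral, [step2] is the [x]-derivative of [step1]: [H2]
    differentiates [H1], and [dd1 - p T] is the derivative of [d1 - w T]. *)
Let approx_der k t x : has_der setT (w_ k t) x (p_ k t x).
Proof.
elim: k t x => [|k IH] t x.
  by rewrite w0 p0; exact: has_der_cst.
have [cw cp] := approx_cont k.
rewrite wS pS /step1 /step2; apply: has_derD; first exact: d0_der.
apply: (@has_der_prim_param _ _ (fun s x => H1 s x (w_ k s x) (d1 x - w_ k T x))
  (fun s x => H2 s x (w_ k s x) (p_ k s x) (d1 x - w_ k T x) (dd1 x - p_ k T x))).
- by move=> y; apply: (joint_cont_l (rhs1_cont cw)).
- by move=> y; apply: (joint_cont_l (rhs2_cont cw cp)).
- exact: clamp_ge0.
- exact: rhs2_cont.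
- by move=> s y; apply: (rhs_der Hrhs) => //; exact: has_derB.
Qed.

Let approx_per k t x : w_ k t (x + L) = w_ k t x /\ p_ k t (x + L) = p_ k t x.
Proof.
elim: k t => [|k IH] t; first by rewrite !w0 !p0.
have wL s : w_ k s (x + L) = w_ k s x by case: (IH s).
have pL s : p_ k s (x + L) = p_ k s x by case: (IH s).
split.
  rewrite (wS k) /step1 d0_per; apply: (congr1 (fun g => d0 x + prim g (clamp T t))).
  by apply/funext => s; rewrite (rhs_per1 Hrhs) !wL d1_per.
rewrite (pS k) /step2 dd0_per; apply: (congr1 (fun g => dd0 x + prim g (clamp T t))).
by apply/funext => s; rewrite (rhs_per2 Hrhs) !wL !pL d1_per dd1_per.
Qed.

(** The damped term integrates to at most [b / 4] times the weight, an antiderivative of exp(4 K s)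
    carrying the factor 1/(4 K). The undamped term in [eta] is at most [b / 4] by [rhs_small]; hence
    the halving. *)
Let bielecki (g h : R -> W) (b t : R) : continuous g -> continuous h -> 0 <= b ->
  (forall s, s \in `[0, T] ->
    `|g s - h s| <= K * (b * expR (4 * K * s)) + eta * (b * expT)) ->
  `|prim g (clamp T t) - prim h (clamp T t)| <=
    b / 2 * expR (4 * K * clamp T t).
Proof.
move=> cg ch b0 gh; set u := clamp T t.
have u0 : 0 <= u := clamp_ge0 _ _.
have uT : u <= T := clamp_le _ T0.
apply: le_trans (prim_le (phi := fun s => b / 4 * expR (4 * K * s) + (eta * (b * expT)) * s)
  (phi' := fun s => K * (b * expR (4 * K * s)) + eta * (b * expT)) cg ch u0 _ _) _.
- move=> s _; apply: has_derD; last exact: has_der_mull.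
  have -> : K * (b * expR (4 * K * s)) = b / 4 * (expR (4 * K * s) * (4 * K)).
    by field.
  exact: (@has_derZl _ _ _ (b / 4) _ _ _ (has_der_expR (4 * K) s)).
- move=> s; rewrite in_itv /= => /andP[s0 su]; apply: gh.
  by rewrite in_itv /= s0 (le_trans su).
rewrite !mulr0 expR0 mulr1 addr0.
have : eta * (b * expT) * u <= b * 4^-1.
  apply: le_trans (_ : eta * (b * expT) * T <= _).
    by rewrite ler_wpM2l // !mulr_ge0 // ltW.
  have -> : eta * (b * expT) * T = b * (eta * T * expT) by ring.
  by rewrite ler_wpM2l // (rhs_small Hrhs).
have : 0 <= b * expR (4 * K * u) by rewrite mulr_ge0 // expR_ge0.
set x := eta * _ * u; set y := expR (4 * K * u); lra.
Qed.

Let expT_ge t : expR (4 * K * clamp T t) <= expT.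
Proof. by rewrite ler_expR ler_pM2l ?mulr_gt0 // clamp_le. Qed.

Let expt_ge1 t : 1 <= expR (4 * K * clamp T t).
Proof. by rewrite -expR0 ler_expR mulr_ge0 ?clamp_ge0 // mulr_ge0 // ltW. Qed.

Let clampT : clamp T T = T.
Proof. by apply: clamp_id; rewrite in_itv /= T0 lexx. Qed.

Let mu_le_r : mu <= r. Proof. by apply: le_trans mu_r; rewrite lerDl. Qed.
Let C_le_r : C <= r. Proof. by apply: le_trans mu_r; rewrite lerDr. Qed.
Let r0 : 0 <= r. Proof. exact: le_trans mu0 mu_le_r. Qed.

Let end_le_r (d w : W) : `|d| <= mu -> `|w| <= C -> `|d - w| <= r.
Proof.
move=> dm wC; apply: le_trans (ler_normB _ _) _.
by apply: le_trans mu_r; exact: lerD.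
Qed.

Let first_step (g : R -> W) (d : W) t : continuous g -> `|d| <= mu ->
  (forall s, `|g s| <= mu) -> `|d + prim g (clamp T t)| <= B.
Proof.
move=> cg dm gm; apply: le_trans (ler_normD _ _) _.
rewrite /B mulrDr mulr1; apply: lerD => //.
have c0 : continuous ((fun=> 0) : R -> W) by exact: cst_continuous.
have := prim_le_cst (M := mu) cg c0 (clamp_ge0 T t) _.
have -> : prim (fun=> 0 : W) (clamp T t) = 0.
  apply/eqP; rewrite -normr_le0.
  have := @mean_value_le _ _ (prim (fun=> 0 : W)) (fun=> 0) (cst 0) (cst 0) 0 (clamp T t)
    (clamp_ge0 _ _).
  rewrite prim0 !subr0; apply=> [s|s _|s _].
  - rewrite in_itv /= => /andP[s0 _]; apply: (@has_der_sub _ _ setT) => //.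
    exact: has_der_prim.
  - exact: has_der_cst.
  - by rewrite normr0.
rewrite subr0 => H; apply: le_trans (H _) _ => [s _|]; first by rewrite subr0.
by rewrite ler_wpM2l // clamp_le.
Qed.

(** The four bounds go together: the Lipschitz estimates are valid only in the ball of radius [r],
    the size of an iterate is controlled by the preceding increments, and the bound on an increment
    is half of the previous one. *)
Let approx_bounds k :
  [/\ forall t x, `|w_ k t x| <= C * (1 - 2^-1 ^+ k),
      forall t x, `|p_ k t x| <= C * (1 - 2^-1 ^+ k),
      forall t x, `|w_ k.+1 t x - w_ k t x| <=
        B * 2^-1 ^+ k * expR (4 * K * clamp T t) &
      forall t x, `|p_ k.+1 t x - p_ k t x| <=
        B * 2^-1 ^+ k * expR (4 * K * clamp T t)].
Proof.
elim: k => [|k [wC pC wB pB]].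
  have zr : `|0 : W| <= r by rewrite normr0.
  have z0 : `|0 - 0 : W| <= 0 by rewrite subrr normr0.
  have [c0 c0'] := approx_cont 0%N; rewrite w0 in c0; rewrite p0 in c0'.
  split=> t x; rewrite ?(wS 0%N) ?(pS 0%N) ?w0 ?p0 ?normr0 ?expr0 ?subrr ?mulr0 ?subr0 ?mulr1 //.
    apply: le_trans (_ : B <= _); last by rewrite ler_peMr.
    apply: first_step => //; first exact: (joint_cont_l (rhs1_cont c0)).
    move=> s; rewrite subr0.
    (* With no change in [w], the Lipschitz estimate costs only [eta * mu], which is at most
       [mu]. *)
    have -> : H1 s x 0 (d1 x) = H1 s x 0 (d1 x) - H1 s x 0 0.
      by rewrite (rhs01 Hrhs) subr0.
    apply: le_trans (rhs_lip1 Hrhs (a := 0) (b := mu) _ _ zr zr _ zr z0 _) _.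
    - exact: le_trans mu_le_r.
    - by rewrite subr0.
    - by rewrite mulr0 add0r ler_piMl.
  apply: le_trans (_ : B <= _); last by rewrite ler_peMr.
  apply: first_step => //.
    exact: (joint_cont_l (rhs2_cont c0 c0')).
  move=> s; rewrite !subr0.
  have -> : H2 s x 0 0 (d1 x) (dd1 x) = H2 s x 0 0 (d1 x) (dd1 x) - H2 s x 0 0 0 0.
    by rewrite (rhs02 Hrhs) subr0.
  apply: le_trans (rhs_lip2 Hrhs (a := 0) (b := mu) _ _ zr zr zr zr _ zr _ zr z0 z0 _ _) _.
  - exact: le_trans mu_le_r.
  - exact: le_trans mu_le_r.
  - by rewrite subr0.
  - by rewrite subr0.
  - by rewrite mulr0 add0r ler_piMl.
have q1 j : C * (1 - 2^-1 ^+ j) <= C.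
  by rewrite -[leRHS]mulr1 ler_wpM2l // gerBl.
(* The increment is at most [C / 2 * 2^-1 ^+ k], exactly the gap between the bounds at [k] and at
   [k.+1]. *)
have incr (u v : W) t : `|u| <= C * (1 - 2^-1 ^+ k) ->
    `|v - u| <= B * 2^-1 ^+ k * expR (4 * K * clamp T t) ->
    `|v| <= C * (1 - 2^-1 ^+ k.+1).
  move=> uC vu; rewrite -[v](subrK u); apply: le_trans (ler_normD _ _) _.
  apply: le_trans (lerD vu uC) _.
  have : B * 2^-1 ^+ k * expR (4 * K * clamp T t) <= B * 2^-1 ^+ k * expT.
    by rewrite ler_wpM2l // mulr_ge0.
  rewrite exprS.
  have -> : B * 2^-1 ^+ k * expT = C / 2 * 2^-1 ^+ k by rewrite /C; field.
  by set x := C; lra.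
have wC' t x : `|w_ k.+1 t x| <= C * (1 - 2^-1 ^+ k.+1) by apply: incr (wC t x) (wB t x).
have pC' t x : `|p_ k.+1 t x| <= C * (1 - 2^-1 ^+ k.+1) by apply: incr (pC t x) (pB t x).
have wr t x : `|w_ k t x| <= C by apply: le_trans (wC _ _) _.
have pr t x : `|p_ k t x| <= C by apply: le_trans (pC _ _) _.
have wr' t x : `|w_ k.+1 t x| <= C by apply: le_trans (wC' _ _) _.
have pr' t x : `|p_ k.+1 t x| <= C by apply: le_trans (pC' _ _) _.
have [cw cp] := approx_cont k; have [cw' cp'] := approx_cont k.+1.
have Bk0 : 0 <= B * 2^-1 ^+ k by rewrite mulr_ge0.
have Bk t : B * 2^-1 ^+ k.+1 * expR (4 * K * clamp T t) =
   (B * 2^-1 ^+ k) / 2 * expR (4 * K * clamp T t) by rewrite exprS; field.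
have endB (d u v : W) : `|u - v| <= B * 2^-1 ^+ k * expR (4 * K * clamp T T) ->
    `|(d - u) - (d - v)| <= B * 2^-1 ^+ k * expT.
  have -> : (d - u) - (d - v) = - (u - v) by lmod_eq R.
  by rewrite clampT normrN.
have wE j t x : w_ j.+1 t x =
  d0 x + prim (fun s => H1 s x (w_ j s x) (d1 x - w_ j T x)) (clamp T t) by rewrite wS.
have pE j t x : p_ j.+1 t x =
  dd0 x + prim (fun s => H2 s x (w_ j s x) (p_ j s x) (d1 x - w_ j T x) (dd1 x - p_ j T x))
    (clamp T t) by rewrite pS.
split=> // t x.
  rewrite (wE k.+1 t x) (wE k t x) Bk opprD addrACA subrr add0r.
  apply: bielecki => // [||s sT].
  - exact: (joint_cont_l (rhs1_cont cw')).
  - exact: (joint_cont_l (rhs1_cont cw)).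
  - apply: (rhs_lip1 Hrhs); try exact: end_le_r; try exact: le_trans C_le_r.
      by have := wB s x; rewrite clamp_id.
    exact/endB/wB.
rewrite (pE k.+1 t x) (pE k t x) Bk opprD addrACA subrr add0r.
apply: bielecki => // [||s sT].
- exact: (joint_cont_l (rhs2_cont cw' cp')).
- exact: (joint_cont_l (rhs2_cont cw cp)).
- apply: (rhs_lip2 Hrhs); try exact: end_le_r; try exact: le_trans C_le_r.
  + by have := wB s x; rewrite clamp_id.
  + by have := pB s x; rewrite clamp_id.
  + exact/endB/wB.
  + exact/endB/pB.
Qed.

(** Both sequences converge uniformly at a geometric rate, so the limit of [p_] is the derivative of
    the limit of [w_]; the recursion passes to the limit as an integral equation, which is then
    differentiated in [t]. *)
Theorem picard_solution : exists w p : R -> R -> W,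
  [/\ joint_cont w, joint_cont p,
      forall t x, has_der setT (w t) x (p t x) &
      [/\ forall t x, t \in `[0, T] ->
            has_der `[0, T] (w^~ x) t (H1 t x (w t x) (d1 x - w T x)),
          forall x, w 0 x = d0 x,
          forall t x, `|w t x| <= C /\ `|p t x| <= C &
          forall t x, w t (x + L) = w t x /\ p t (x + L) = p t x]].
Proof.
have BE k t : B * 2^-1 ^+ k * expR (4 * K * clamp T t) <= C / 2 * 2^-1 ^+ k.
  rewrite [leRHS](_ : _ = B * 2^-1 ^+ k * expT); last by rewrite /C; field.
  by rewrite ler_wpM2l // mulr_ge0.
have /choice[w wP] (z : R * R) : exists l : W, forall k,
    `|l - w_ k z.1 z.2| <= C * 2^-1 ^+ k.
  have [l Hl] := geometric_limit (u := fun k => w_ k z.1 z.2) (B := C / 2)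
    (fun k => le_trans (let: And4 _ _ h _ := approx_bounds k in h z.1 z.2) (BE k z.1)).
  by exists l => k; have := Hl k; rewrite [2 * (C / 2)](_ : _ = C) //; field.
have /choice[p pP] (z : R * R) : exists l : W, forall k,
    `|l - p_ k z.1 z.2| <= C * 2^-1 ^+ k.
  have [l Hl] := geometric_limit (u := fun k => p_ k z.1 z.2) (B := C / 2)
    (fun k => le_trans (let: And4 _ _ _ h := approx_bounds k in h z.1 z.2) (BE k z.1)).
  by exists l => k; have := Hl k; rewrite [2 * (C / 2)](_ : _ = C) //; field.
pose w' t x := w (t, x); pose p' t x := p (t, x).
have wP' k t x : `|w' t x - w_ k t x| <= C * 2^-1 ^+ k := wP (t, x) k.
have pP' k t x : `|p' t x - p_ k t x| <= C * 2^-1 ^+ k := pP (t, x) k.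
have cw : joint_cont w' by apply: joint_cont_limit wP' => k; case: (approx_cont k).
have cp : joint_cont p' by apply: joint_cont_limit pP' => k; case: (approx_cont k).
have wC t x : `|w' t x| <= C.
  by have := wP' 0%N t x; rewrite w0 subr0 expr0 mulr1.
have pC t x : `|p' t x| <= C.
  by have := pP' 0%N t x; rewrite p0 subr0 expr0 mulr1.
have limit_eq (M : R) (a b : W) : (forall k, `|a - b| <= M * 2^-1 ^+ k) -> a = b.
  move=> ab; apply/eqP; rewrite -subr_eq0 -normr_le0; apply/ler_addgt0Pr => e e0.
  have [k Hk] := geometric_small M e0.
  by rewrite add0r (le_trans (ab k)) // ltW.
have wfix t x : w' t x =
    d0 x + prim (fun s => H1 s x (w' s x) (d1 x - w' T x)) (clamp T t).
  (* The 1 accounts for the distance to the iterate [k.+1], and [(K + eta) * T] for the Lipschitz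
     error under an integral of length at most [T]. *)
  apply: (limit_eq ((1 + (K + eta) * T) * C)) => k; have [wk _ _ _] := approx_bounds k.
  have wkC s y : `|w_ k s y| <= C.
    by apply: le_trans (wk s y) _; rewrite -[leRHS]mulr1 ler_wpM2l // gerBl.
  have h1 : `|w' t x - w_ k.+1 t x| <= C * 2^-1 ^+ k.
    apply: le_trans (wP' k.+1 t x) _; rewrite exprS ler_wpM2l // ler_piMl //; lra.
  have h2 : `|prim (fun s => H1 s x (w_ k s x) (d1 x - w_ k T x)) (clamp T t) -
      prim (fun s => H1 s x (w' s x) (d1 x - w' T x)) (clamp T t)| <=
      (K + eta) * (C * 2^-1 ^+ k) * T.
    apply: le_trans (_ : (K + eta) * (C * 2^-1 ^+ k) * clamp T t <= _); last first.
      by rewrite ler_wpM2l ?clamp_le // !mulr_ge0 // addr_ge0 // ltW.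
    apply: prim_le_cst; [|exact: (joint_cont_l (rhs1_cont cw))|exact: clamp_ge0|].
      exact: (joint_cont_l (rhs1_cont (approx_cont k).1)).
    move=> s _; rewrite mulrDl; apply: (rhs_lip1 Hrhs);
      try exact: end_le_r; try exact: le_trans C_le_r.
    - by rewrite distrC.
    - by have -> : d1 x - w_ k T x - (d1 x - w' T x) = w' T x - w_ k T x by lmod_eq R.
  have e1 : w_ k.+1 t x =
    d0 x + prim (fun s => H1 s x (w_ k s x) (d1 x - w_ k T x)) (clamp T t) by rewrite wS.
  have := ler_distD (w_ k.+1 t x) (w' t x)
    (d0 x + prim (fun s => H1 s x (w' s x) (d1 x - w' T x)) (clamp T t)).
  rewrite {2}e1 opprD addrACA subrr add0r.
  move=> h3; apply: le_trans h3 _; apply: le_trans (lerD h1 h2) _.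
  by rewrite le_eqVlt; apply/orP; left; apply/eqP; ring.
exists w', p'; split=> //.
  move=> t x; apply: (@has_der_limit _ _ (fun k => w_ k t) (fun k => p_ k t) _ (p' t) C) => //.
  exact: joint_cont_r.
split=> [t x tT|x||t x].
- apply: (@has_der_eq _ _ _ (fun t => d0 x + prim (fun s => H1 s x (w' s x) (d1 x - w' T x)) t)).
  + exact: tT.
  + by move=> s sT; rewrite [RHS]wfix clamp_id.
  rewrite -[H1 _ _ _ _]add0r; apply: has_derD; first exact: has_der_cst.
  apply: (@has_der_sub _ _ setT) => //.
  apply: (@has_der_prim _ _ (fun s => H1 s x (w' s x) (d1 x - w' T x))).
    exact: (joint_cont_l (rhs1_cont cw)).
  by move: tT; rewrite in_itv /= => /andP[].
- have c0 : clamp T 0 = 0 by rewrite clamp_id // in_itv /= lexx.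
  by rewrite wfix c0 prim0 addr0.
- by move=> t x; split; [exact: wC|exact: pC].
- have per (f : R -> W) (g : nat -> R -> W) : (forall k y, `|f y - g k y| <= C * 2^-1 ^+ k) ->
      (forall k, g k (x + L) = g k x) -> f (x + L) = f x.
    move=> fg gper; apply: (limit_eq (2 * C)) => k.
    apply: le_trans (ler_distD (g k x) _ _) _.
    have := fg k x; have := fg k (x + L).
    rewrite gper [`|f x - _|]distrC => h1 h2.
    by apply: le_trans (lerD h1 h2) _; rewrite -mulrA mulrDl mul1r.
  split.
    apply: (per (w' t) (fun k => w_ k t)) => [k y|k]; first exact: wP'.
    by case: (approx_per k t x).
  apply: (per (p' t) (fun k => p_ k t)) => [k y|k]; first exact: pP'.
  by case: (approx_per k t x).
Qed.

End BoundaryValuePicard.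

(** [picard_solution] knows the iterates only by their recursion equations; here they are realized
    by iterating on the pair [(w, p)]. *)
Theorem two_point_problem (R : realType) (n : nat) (T L K eta r : R)
    (H1 : R -> R -> 'rV[R]_n -> 'rV[R]_n -> 'rV[R]_n)
    (H2 : R -> R -> 'rV[R]_n -> 'rV[R]_n -> 'rV[R]_n -> 'rV[R]_n -> 'rV[R]_n)
    (d0 dd0 d1 dd1 : R -> 'rV[R]_n) (mu : R) :
  admissible_rhs T L K eta r H1 H2 ->
  (forall x, has_der setT d0 x (dd0 x)) -> (forall x, has_der setT d1 x (dd1 x)) ->
  continuous dd0 -> continuous dd1 ->
  (forall x, [/\ `|d0 x| <= mu, `|dd0 x| <= mu, `|d1 x| <= mu & `|dd1 x| <= mu]) ->
  (forall x, [/\ d0 (x + L) = d0 x, dd0 (x + L) = dd0 x, d1 (x + L) = d1 x &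
     dd1 (x + L) = dd1 x]) ->
  let C := 2 * (mu * (1 + T)) * expR (4 * K * T) in
  mu + C <= r ->
  exists w p : R -> R -> 'rV[R]_n,
  [/\ joint_cont w, joint_cont p,
      forall t x, has_der setT (w t) x (p t x) &
      [/\ forall t x, t \in `[0, T] ->
            has_der `[0, T] (w^~ x) t (H1 t x (w t x) (d1 x - w T x)),
          forall x, w 0 x = d0 x,
          forall t x, `|w t x| <= C /\ `|p t x| <= C &
          forall t x, w t (x + L) = w t x /\ p t (x + L) = p t x]].
Proof.
move=> Hrhs d0d d1d dd0c dd1c dmu dper C muC.
pose approx k := iter k (fun wp : (R -> R -> 'rV[R]_n) * (R -> R -> 'rV[R]_n) =>
  (fun t x => d0 x + prim (fun s => H1 s x (wp.1 s x) (d1 x - wp.1 T x)) (clamp T t),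
   fun t x => dd0 x + prim (fun s => H2 s x (wp.1 s x) (wp.2 s x)
     (d1 x - wp.1 T x) (dd1 x - wp.2 T x)) (clamp T t)))
  (fun=> fun=> 0, fun=> fun=> 0).
apply: (picard_solution Hrhs d0d d1d dd0c dd1c _ _ _ _ _ _ _ _ muC
  (w_ := fun k => (approx k).1) (p_ := fun k => (approx k).2)) => //;
  by move=> x; case: (dmu x) (dper x) => ? ? ? ? [? ? ? ?].
Qed.

(** * Functions of class C^1 on the rectangle and periodic extension *)

Section SegmentDerivative.
Context {R : realType} {W : normedModType R}.
Implicit Types (g : R -> W) (c s : R).

(** Small increments to the right stay in [[0, c]] when [s < c], and those to the left when [s = c].
    Properness makes limits unique, so that [seg_derive] agrees with [has_der]. *)
Lemma seg_increments_proper c s : 0 < c -> s \in `[0, c] ->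
  ProperFilter (within [set h | h + s \in `[0, c]] (0 : R)^').
Proof.
move=> c0; rewrite in_itv /= => /andP[s0 sc].
apply: Build_ProperFilter_ex => P /nbhs_ballP[d /= d0 Pd].
have d20 : 0 < d / 2 by rewrite divr_gt0.
have dd : d / 2 < d by rewrite ltr_pdivrMr // ltr_pMr // ltrDl.
have P' h : `|h| < d -> h != 0 -> h + s \in `[0, c] -> P h.
  by move=> hd h0; apply: Pd => //; rewrite -ball_normE /= sub0r normrN.
have [sc'|cs] := ltP s c.
  exists (Num.min (d / 2) (c - s)).
  have m0 : 0 < Num.min (d / 2) (c - s) by rewrite lt_min d20 subr_gt0.
  apply: P'; first by rewrite gtr0_norm // gt_min dd.
    by rewrite gt_eqF.
  rewrite in_itv /= addr_ge0 ?(ltW m0) //=.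
  by rewrite -lerBrDr ge_min lexx orbT.
exists (- Num.min (d / 2) c).
have m0 : 0 < Num.min (d / 2) c by rewrite lt_min d20.
apply: P'; first by rewrite normrN gtr0_norm // gt_min dd.
  by rewrite oppr_eq0 gt_eqF.
rewrite in_itv /= addrC subr_ge0 (le_trans _ cs) /=; last by rewrite ge_min lexx orbT.
by rewrite lerBlDr (le_trans sc) // lerDl ltW.
Qed.

Lemma has_der_seg c g s (d : W) : 0 < c -> s \in `[0, c] ->
  has_der `[0, c] g s d -> seg_derivable c g s /\ seg_derive c g s = d.
Proof.
move=> c0 sc gd; have PF := seg_increments_proper c0 sc.
suff cv : seg_quotient c g s --> d.
  by split; [apply/cvg_ex; exists d | exact: cvg_lim].
apply/cvgrPdist_le => e /gd[r r0 Hr].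
apply/nbhs_ballP; exists r => // h; rewrite -ball_normE /= sub0r normrN => hr h0 hs.
have := Hr (h + s) hs; rewrite addrK => /(_ hr) H.
have hn : 0 < `|h| by rewrite normr_gt0.
have -> : d - h^-1 *: (g (h + s) - g s) = - (h^-1 *: (g (h + s) - g s - h *: d)).
  by rewrite [in RHS]scalerBr scalerA mulVf // scale1r opprB.
rewrite normrN normrZ normfV mulrC ler_pdivrMr //.
Qed.

Lemma seg_has_der c g s : 0 < c -> s \in `[0, c] ->
  seg_derivable c g s -> has_der `[0, c] g s (seg_derive c g s).
Proof.
move=> c0 sc gd e e0; have PF := seg_increments_proper c0 sc.
have /cvgrPdist_le/(_ e e0)/nbhs_ballP[r r0 Hr] := gd.
exists r => // t tc ts; have [->|tns] := eqVneq t s.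
  by rewrite !subrr scale0r subr0 !normr0 mulr0.
have h0 : t - s != 0 by rewrite subr_eq0.
have hn : 0 < `|t - s| by rewrite normr_gt0.
have := Hr (t - s); rewrite -ball_normE /= sub0r normrN => /(_ ts h0).
rewrite subrK => /(_ tc); rewrite -/(seg_derive c g s) => H.
rewrite -(scalerKV h0 (g t - g s)) -scalerBr normrZ mulrC ler_pM2r //.
by rewrite distrC.
Qed.

End SegmentDerivative.

Section C1Data.
Context {R : realType} {W : normedModType R} (T L : R).
Implicit Types (y : R * R -> W).

(** Derivatives are carried as given functions, so that sums, products and transport yield explicit
    formulas; [data_C1per] identifies them with [dt] and [dx] afterwards. *)
Record C1_data y yt yx : Prop := MkC1Data {
  data_cont : {within rect T L, continuous y};
  data_contt : {within rect T L, continuous yt};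
  data_contx : {within rect T L, continuous yx};
  data_dert : forall z, rect T L z -> has_der `[0, T] (fun s => y (s, z.2)) z.1 (yt z);
  data_derx : forall z, rect T L z -> has_der `[0, L] (fun s => y (z.1, s)) z.2 (yx z);
  data_per : forall t, t \in `[0, T] -> y (t, 0) = y (t, L) /\ yx (t, 0) = yx (t, L) }.

Lemma within_cont_eq (A : set (R * R)) (y z : R * R -> W) :
  (forall p, A p -> y p = z p) ->
  {within A, continuous y} -> {within A, continuous z}.
Proof.
move=> yz /within_contP cy; apply/within_contP => p Ap e e0.
have [d d0 Hd] := cy p Ap e e0; exists d => // q Aq qp.
by rewrite -!yz //; apply: Hd.
Qed.

Context (T0 : 0 < T) (L0 : 0 < L).

Lemma C1per_data y : C1per_rect T L y -> C1_data y (dt T y) (dx L y).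
Proof.
move=> [[cy dery ct cx] per]; split=> //.
- move=> [t x] [/= tT xL]; apply: seg_has_der => //.
  by case: (dery t x).
- move=> [t x] [/= tT xL]; apply: seg_has_der => //.
  by case: (dery t x).
Qed.

Lemma data_C1per y yt yx : C1_data y yt yx ->
  C1per_rect T L y /\ forall z, rect T L z -> dt T y z = yt z /\ dx L y z = yx z.
Proof.
move=> [cy ct cx dert derx per].
have D z : rect T L z -> dt T y z = yt z /\ dx L y z = yx z.
  move=> zr; have [tT xL] := zr.
  by split; [have [] := has_der_seg T0 tT (dert z zr)
            |have [] := has_der_seg L0 xL (derx z zr)].
split=> //; split.
  split=> //.
  - move=> t x zr; have [tT xL] := zr; split.
      by have [] := has_der_seg T0 tT (dert (t, x) zr).
    by have [] := has_der_seg L0 xL (derx (t, x) zr).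
  - by apply: within_cont_eq ct => z /D[].
  - by apply: within_cont_eq cx => z /D[].
move=> t tT; have [y0 yx0] := per t tT; split=> //.
have l0 : 0 \in `[0, L] by rewrite in_itv /= lexx ltW.
have lL : L \in `[0, L] by rewrite in_itv /= lexx ltW.
by rewrite (D (t, 0) _).2 // (D (t, L) _).2.
Qed.

Lemma C1_dataD y yt yx z zt zx : C1_data y yt yx -> C1_data z zt zx ->
  C1_data (fun p => y p + z p) (fun p => yt p + zt p) (fun p => yx p + zx p).
Proof.
move=> [cy ct cx dert derx per] [cy' ct' cx' dert' derx' per']; split.
- by move=> p; apply: cvgD; [exact: cy|exact: cy'].
- by move=> p; apply: cvgD; [exact: ct|exact: ct'].
- by move=> p; apply: cvgD; [exact: cx|exact: cx'].
- by move=> p pr; apply: has_derD; [exact: dert|exact: dert'].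
- by move=> p pr; apply: has_derD; [exact: derx|exact: derx'].
- by move=> t tT; have [-> ->] := per t tT; have [-> ->] := per' t tT.
Qed.

Lemma C1_data0 : C1_data (fun=> 0) (fun=> 0) (fun=> 0).
Proof.
have c0 : {within rect T L, continuous ((fun=> 0) : R * R -> W)}.
  by apply/within_contP => p _ e e0; exists 1 => // q _ _; rewrite subrr normr0.
split=> //.
- by move=> p _; exact: has_der_cst.
- by move=> p _; exact: has_der_cst.
Qed.

Lemma C1_data_sum (I : finType) (y yt yx : I -> R * R -> W) :
  (forall i, C1_data (y i) (yt i) (yx i)) ->
  C1_data (fun p => \sum_i y i p) (fun p => \sum_i yt i p) (fun p => \sum_i yx i p).
Proof.
move=> H; have E (f : I -> R * R -> W) : (fun p => \sum_i f i p) = \sum_i f i.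
  by apply/funext => p; rewrite fct_sumE.
rewrite !E; elim/big_rec3 : _ => [|i y1 y2 y3 _ IH]; first exact: C1_data0.
exact: C1_dataD (H i) IH.
Qed.

End C1Data.

Section Transport.
Context {R : realType} {W : normedModType R} (T L : R).

(** Return from the characteristic variable to [x]. A time step splits into a move of the second
    argument at the new time, controlled by the joint continuity of [p], and a move in time at a
    fixed label, controlled by [wt]. The two partial derivatives add up to [wt]. *)
Lemma transport_data (w p wt : R -> R -> W) :
  continuous (fun z : R * R => w z.1 z.2) ->
  continuous (fun z : R * R => p z.1 z.2) ->
  continuous (fun z : R * R => wt z.1 z.2) ->
  (forall t x, has_der setT (w t) x (p t x)) ->
  (forall t x, t \in `[0, T] -> has_der `[0, T] (w^~ x) t (wt t x)) ->
  (forall t x, w t (x + L) = w t x /\ p t (x + L) = p t x) ->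
  C1_data T L (fun z => w z.1 (z.2 - z.1))
    (fun z => wt z.1 (z.2 - z.1) - p z.1 (z.2 - z.1))
    (fun z => p z.1 (z.2 - z.1)).
Proof.
move=> cw cp cwt wp wwt per.
have cm (g : R -> R -> W) : continuous (fun z : R * R => g z.1 z.2) ->
    continuous (fun z : R * R => g z.1 (z.2 - z.1)).
  move=> cg z; apply: (@continuous_comp _ _ _ (fun z : R * R => (z.1, z.2 - z.1))
    (fun z : R * R => g z.1 z.2)); last exact: cg.
  apply: continuous_at_pair; first exact: cvg_fst.
  by apply: cvgB; [exact: cvg_snd | exact: cvg_fst].
split.
- exact/continuous_subspaceT/cm.
- by apply: continuous_subspaceT => z; apply: cvgB; [exact: cm cwt z|exact: cm cp z].
- exact/continuous_subspaceT/cm.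
- move=> [t x] [/= tT xL] e e0; have e20 : 0 < e / 2 by rewrite divr_gt0.
  have [d d0 Hd] := wwt t (x - t) tT _ e20.
  have /cont_atP/(_ _ e20)[d' d'0 Hd'] := cp (t, x - t).
  exists (Num.min d d'); first by rewrite lt_min d0.
  move=> s sT; rewrite lt_min => /andP[sd sd'].
  have -> : w s (x - s) - w t (x - t) - (s - t) *: (wt t (x - t) - p t (x - t)) =
      (w s (x - s) - w s (x - t) - ((x - s) - (x - t)) *: p t (x - t)) +
      (w s (x - t) - w t (x - t) - (s - t) *: wt t (x - t)) by lmod_eq R.
  have xst : `|x - s - (x - t)| = `|s - t|.
    by rewrite distrC; congr (`|_|); ring.
  apply: le_trans (ler_normD _ _) _; rewrite (splitr e) mulrDl; apply: lerD; last exact: Hd.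
  rewrite -xst; apply: (mean_value_segment (g' := p s)) => // z; rewrite xst => zx.
  apply/ltW; apply: (Hd' (s, z)); rewrite pair_norm_lt /= sd' /=.
  exact: le_lt_trans sd'.
- move=> [t x] _ /= e /(wp t (x - t))[d d0 Hd]; exists d => // s _ sx.
  have := Hd (s - t) I; rewrite (_ : s - t - (x - t) = s - x); last by ring.
  exact.
- move=> t _ /=; have [<- <-] := per t (0 - t).
  by rewrite sub0r addrC.
Qed.

Lemma C1_data_scale (k kt kx : R * R -> R) (y yt yx : R * R -> W) :
  C1_data T L k kt kx -> C1_data T L y yt yx ->
  C1_data T L (fun p => k p *: y p) (fun p => k p *: yt p + kt p *: y p)
    (fun p => k p *: yx p + kx p *: y p).
Proof.
move=> [cy ct cx dert derx per] [cy' ct' cx' dert' derx' per']; split.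
- by move=> p; apply: cvgZ; [exact: cy|exact: cy'].
- by move=> p; apply: cvgD; apply: cvgZ; [exact: cy|exact: ct'|exact: ct|exact: cy'].
- by move=> p; apply: cvgD; apply: cvgZ; [exact: cy|exact: cx'|exact: cx|exact: cy'].
- by move=> [t x] pr; apply: (has_derZ (dert _ pr) (dert' _ pr)).
- by move=> [t x] pr; apply: (has_derZ (derx _ pr) (derx' _ pr)).
- by move=> t tT; have [-> ->] := per t tT; have [-> ->] := per' t tT.
Qed.

End Transport.

Section PeriodicExtension.
Context {R : realType} (L : R) (L0 : 0 < L).

Definition pmod (x : R) : R := x - (Num.floor (x / L))%:~R * L.

Lemma pmodE (k : int) (y : R) : 0 <= y < L -> pmod (k%:~R * L + y) = y.
Proof.
move=> /andP[y0 yL]; rewrite /pmod.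
have -> : Num.floor ((k%:~R * L + y) / L) = k.
  apply: floor_def; rewrite mulrDl mulfK ?gt_eqF // lerDl divr_ge0 ?(ltW L0) //=.
  by rewrite intrD ltrD2l ltr_pdivrMr // mul1r.
by rewrite addrC addKr.
Qed.

Lemma pmod_itv x : 0 <= pmod x < L.
Proof.
have /andP[h1 h2] := floor_itv (x / L).
rewrite ler_pdivlMr // in h1; rewrite ltr_pdivrMr // intrD mulrDl mul1r in h2.
by rewrite /pmod subr_ge0 h1 /= ltrBlDl.
Qed.

Lemma pmod_id x : 0 <= x < L -> pmod x = x.
Proof. by move=> xL; have := pmodE 0 xL; rewrite mul0r add0r. Qed.

Lemma pmod_int x (h : R) : exists k : int, x + h = k%:~R * L + (pmod x + h).
Proof. by exists (Num.floor (x / L)); rewrite /pmod; ring. Qed.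

Lemma pmodDL x : pmod (x + L) = pmod x.
Proof.
have [k ->] := pmod_int x L.
have -> : k%:~R * L + (pmod x + L) = (k + 1)%:~R * L + pmod x by rewrite intrD; ring.
by rewrite pmodE // pmod_itv.
Qed.

(* Near [x] the extension is read off at [a] on the right and at [b] on the left;
   these differ only at the multiples of [L]. *)
Lemma pmod_local x : exists a b d : R,
  [/\ a \in `[0, L], b \in `[0, L], 0 < d, pmod x = a &
  [/\ a = b \/ (a = 0 /\ b = L),
      forall h, 0 <= h -> h < d -> pmod (x + h) = a + h /\ a + h \in `[0, L] &
      forall h, - d < h -> h < 0 -> pmod (x + h) = b + h /\ b + h \in `[0, L]]].
Proof.
have /andP[x0 xL] := pmod_itv x.
have right d : d <= L - pmod x -> forall h, 0 <= h -> h < d ->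
    pmod (x + h) = pmod x + h /\ pmod x + h \in `[0, L].
  move=> dL h h0 hd; have [k ->] := pmod_int x h.
  rewrite pmodE; last by apply/andP; split; lra.
  by rewrite in_itv /=; split=> //; apply/andP; split; lra.
have [p0|] := eqVneq (pmod x) 0.
  exists 0, L, L; split; rewrite ?in_itv /= ?lexx ?(ltW L0) //.
  split; first by right.
    by have := right L; rewrite p0 subr0 => /(_ (lexx _)).
  move=> h hL h0; have [k ->] := pmod_int x h.
  have -> : k%:~R * L + (pmod x + h) = (k - 1)%:~R * L + (L + h).
    by rewrite p0 intrD; ring.
  rewrite pmodE; last by apply/andP; split; lra.
  by rewrite in_itv /=; split=> //; apply/andP; split; lra.
move=> pn; have p0 : 0 < pmod x by rewrite lt_neqAle eq_sym pn.
exists (pmod x), (pmod x), (Num.min (pmod x) (L - pmod x)).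
have dm : Num.min (pmod x) (L - pmod x) <= pmod x by rewrite ge_min lexx.
have dm' : Num.min (pmod x) (L - pmod x) <= L - pmod x by rewrite ge_min lexx orbT.
split; rewrite ?in_itv /= ?x0 ?(ltW xL) //; first by rewrite lt_min p0 subr_gt0.
split; first by left.
  exact: right.
move=> h hL h0; have [k ->] := pmod_int x h.
rewrite pmodE; last by apply/andP; split; lra.
by rewrite in_itv /=; split=> //; apply/andP; split; lra.
Qed.

Context {W : normedModType R} (T : R) (T0 : 0 < T).

Definition pext (u : R * R -> W) (t x : R) : W := u (clamp T t, pmod x).

Lemma pext_per u t x : pext u t (x + L) = pext u t x.
Proof. by rewrite /pext pmodDL. Qed.

(** Agreement at [x = L] rests on the periodicity of [u], since [pmod] sends [L] to 0. *)
Lemma pext_id u t x : (forall t, t \in `[0, T] -> u (t, 0) = u (t, L)) ->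
  rect T L (t, x) -> pext u t x = u (t, x).
Proof.
move=> uL [/= tT]; rewrite in_itv /= => /andP[x0].
rewrite /pext clamp_id // le_eqVlt => /orP[/eqP ->|xL]; last by rewrite pmod_id ?x0.
have := pmodE 1 (y := 0); rewrite lexx L0 addr0 mul1r => -> //.
by rewrite uL.
Qed.

Lemma pext_cont u : {within rect T L, continuous u} ->
  (forall t, t \in `[0, T] -> u (t, 0) = u (t, L)) ->
  continuous (fun z : R * R => pext u z.1 z.2).
Proof.
move=> /within_contP cu uL [t x]; apply/cont_atP => e e0 /=.
have [a [b [d [aL bL d0 xa [ab right left]]]]] := pmod_local x.
have cT s : clamp T s \in `[0, T] by apply: clamp_in; exact: ltW.
have ra : rect T L (clamp T t, a) := conj (cT t) aL.
have rb : rect T L (clamp T t, b) := conj (cT t) bL.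
have uab : u (clamp T t, b) = u (clamp T t, a).
  by case: ab => [->//|[-> ->]]; rewrite uL.
have [d1 d10 H1] := cu _ ra e e0; have [d2 d20 H2] := cu _ rb e e0.
have d120 : 0 < Num.min d1 d2 by rewrite lt_min d10.
have /cont_atP/(_ _ d120)[d3 d30 H3] := @continuous_clamp R T t.
exists (Num.min d (Num.min d1 (Num.min d2 d3))); first by rewrite !lt_min d0 d10 d20.
move=> [t' x']; rewrite pair_norm_lt /= !lt_min.
move=> /andP[/and4P[_ _ _ /H3]]; rewrite lt_min => /andP[t1 t2] /and4P[xd x1 x2 _].
rewrite /pext xa.
have xE : x' = x + (x' - x) by rewrite addrC subrK.
have [xx|xx] := leP 0 (x' - x).
  rewrite (ger0_norm xx) in xd.
  have [] := right _ xx xd; rewrite -xE => -> h.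
  apply: H1; first exact: (conj (cT t') h).
  by rewrite pair_norm_lt /= t1 /= addrC addKr.
rewrite ltr_norml in xd; have /andP[xd1 xd2] := xd.
have [] := left _ xd1 xx; rewrite -xE => -> h; rewrite -uab.
apply: H2; first exact: (conj (cT t') h).
by rewrite pair_norm_lt /= t2 /= addrC addKr.
Qed.

(** At a multiple of [L] the one-sided derivatives are [ux] at 0 and at [L]; their equality glues
    them into a two-sided derivative. *)
Lemma pext_der u ux t x :
  (forall z, rect T L z -> has_der `[0, L] (fun s => u (z.1, s)) z.2 (ux z)) ->
  (forall t, t \in `[0, T] -> u (t, 0) = u (t, L) /\ ux (t, 0) = ux (t, L)) ->
  has_der setT (pext u t) x (pext ux t x).
Proof.
move=> ud uL e e0.
have [a [b [d [aL bL d0 xa [ab right left]]]]] := pmod_local x.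
have cT s : clamp T s \in `[0, T] by apply: clamp_in; exact: ltW.
have [u0L ux0L] := uL _ (cT t).
have uab : u (clamp T t, b) = u (clamp T t, a).
  by case: ab => [->//|[-> ->]].
have uxab : ux (clamp T t, b) = ux (clamp T t, a).
  by case: ab => [->//|[-> ->]].
have [d1 d10 H1] := ud (clamp T t, a) (conj (cT t) aL) e e0.
have [d2 d20 H2] := ud (clamp T t, b) (conj (cT t) bL) e e0.
exists (Num.min d (Num.min d1 d2)); first by rewrite !lt_min d0 d10.
move=> x' _; rewrite !lt_min => /and3P[xd x1 x2]; rewrite /pext xa.
have xE : x' = x + (x' - x) by rewrite addrC subrK.
have aE c : c + (x' - x) - c = x' - x by rewrite addrC addKr.
have [xx|xx] := leP 0 (x' - x).
  rewrite (ger0_norm xx) in xd.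
  have [] := right _ xx xd; rewrite -xE => -> h.
  by have := H1 _ h; rewrite /= aE; apply.
rewrite ltr_norml in xd; have /andP[xd1 xd2] := xd.
have [] := left _ xd1 xx; rewrite -xE => -> h; rewrite -uab -uxab.
by have := H2 _ h; rewrite /= aE; apply.
Qed.

End PeriodicExtension.

(** * The remainder of the nonlinear equation *)

Lemma norm_comb_le (R : realType) n (V : normedModType R) (M b : R) (c d : 'rV[R]_n)
    (g h : 'I_n -> V) : `|c| <= b -> `|d| <= b ->
  (forall i, `|g i| <= M) -> (forall i, `|h i| <= M) ->
  `|\sum_i (c 0 i *: g i + d 0 i *: h i)| <= 2 * M * n%:R * b.
Proof.
move=> cb db gM hM; apply: le_trans (ler_norm_sum _ _ _) _.
apply: le_trans (_ : \sum_(i < n) 2 * M * b <= _).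
  apply: ler_sum => i _; apply: le_trans (ler_normD _ _) _; rewrite !normrZ.
  have h1 : `|c 0 i| * `|g i| <= b * M.
    by apply: ler_pM => //; apply: le_trans (mx_coord_le _ _) cb.
  have h2 : `|d 0 i| * `|h i| <= b * M.
    by apply: ler_pM => //; apply: le_trans (mx_coord_le _ _) db.
  by apply: le_trans (lerD h1 h2) _; rewrite le_eqVlt; apply/orP; left; apply/eqP; ring.
by rewrite sumr_const card_ord -mulr_natr le_eqVlt; apply/orP; left; apply/eqP; ring.
Qed.

Section RemainderRhs.
Context {R : realType} {n : nat} {V : normedModType R}.
Local Notation W := 'rV[R]_n.
Context (f : V -> W) (df : V -> V -> W) (dPhi : V * V -> V * V -> W).
Local Notation Phi := (fun z : V * V => df z.1 z.2).
Context (cV : compact_balls V) (f_C1 : C1_map f df) (Phi_C1 : C1_map Phi dPhi).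
Context (dPhi_r : forall u v k, dPhi (u, v) (0, k) = df u k).
Context (iota : W -> V) (iotaB : forall x y, iota (x - y) = iota x - iota y)
  (iotaZ : forall (a : R) x, iota (a *: x) = a *: iota x)
  (iota_le : forall x, `|iota x| <= `|x|).
Context (T L M : R) (T0 : 0 <= T) (M0 : 0 <= M).
Context (q qx : R -> R -> V) (e ex : 'I_n -> R -> R -> V).
Local Notation jcont g := (continuous (fun z : R * R => g z.1 z.2)).
Context (q_cont : jcont q) (qx_cont : jcont qx)
  (e_cont : forall i, jcont (e i)) (ex_cont : forall i, jcont (ex i)).
Context (q_der : forall t x, has_der setT (q t) x (qx t x))
  (e_der : forall i t x, has_der setT (e i t) x (ex i t x)).
Context (qM : forall t x, `|q t x| <= M) (qxM : forall t x, `|qx t x| <= M)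
  (eM : forall i t x, `|e i t x| <= M) (exM : forall i t x, `|ex i t x| <= M).
Context (q_per : forall t x, q t (x + L) = q t x)
  (qx_per : forall t x, qx t (x + L) = qx t x)
  (e_per : forall i t x, e i t (x + L) = e i t x)
  (ex_per : forall i t x, ex i t (x + L) = ex i t x).

(* With [q] the trajectory [(ytilde, Thetatilde)] and [e i] the controlled linear
   solutions [(y_i, Theta_i)], all read along characteristics, [rhs1] is what
   remains of the equation for [w] once the equations satisfied by [q] and by
   the [e i] are subtracted; [iota] puts [w] in the state component. *)
Definition comb (t x : R) (c : W) : V := \sum_i c 0 i *: e i t x.
Definition dcomb (t x : R) (c d : W) : V :=
  \sum_i (c 0 i *: ex i t x + d 0 i *: e i t x).

Definition rhs1 t x (w c : W) : W :=
  f (q t x + (comb t x c + iota w)) - f (q t x) - df (q t x) (comb t x c).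

(** The same expression as [rhs1], with [f] replaced by the tangent map [Phi] and the base point [q]
    by [(q, qx)]; hence the same kind of estimate serves both. *)
Definition rhs2 t x (w p c d : W) : W :=
  df (q t x + (comb t x c + iota w)) (qx t x + (dcomb t x c d + iota p))
  - df (q t x) (qx t x) - dPhi (q t x, qx t x) (comb t x c, dcomb t x c d).

Let iota0 : iota 0 = 0. Proof. by rewrite -(subrr (0 : W)) iotaB subrr. Qed.

Let combB t x c c' : comb t x (c - c') = comb t x c - comb t x c'.
Proof. by rewrite /comb -sumrB; apply: eq_bigr => i _; rewrite !mxE scalerBl. Qed.

Let dcombB t x c c' d d' :
  dcomb t x (c - c') (d - d') = dcomb t x c d - dcomb t x c' d'.
Proof.
rewrite /dcomb -sumrB; apply: eq_bigr => i _; rewrite !mxE; by lmod_eq R.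
Qed.

Let comb0 t x : comb t x 0 = 0.
Proof. by rewrite /comb big1 // => i _; rewrite mxE scale0r. Qed.

Let dcomb0 t x : dcomb t x 0 0 = 0.
Proof. by rewrite /dcomb big1 // => i _; rewrite !mxE !scale0r addr0. Qed.

Let N : R := 2 * M * n%:R.
Let N0 : 0 <= N. Proof. by rewrite !mulr_ge0. Qed.

Let comb_le t x c b : `|c| <= b -> `|comb t x c| <= N * b.
Proof.
move=> cb; have b0 : 0 <= b := le_trans (normr_ge0 _) cb.
have := @norm_comb_le _ _ _ M b c 0 (fun i => e i t x) (fun i => e i t x) cb _
  (fun i => eM i t x) (fun i => eM i t x).
rewrite normr0 => /(_ b0); rewrite (eq_bigr (fun i => c 0 i *: e i t x)) //.
by move=> i _; rewrite mxE scale0r addr0.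
Qed.

Let dcomb_le t x c d b : `|c| <= b -> `|d| <= b -> `|dcomb t x c d| <= N * b.
Proof. by move=> cb db; apply: norm_comb_le. Qed.

(* The derivative in [x] of [df q (comb c)] is [dPhi (q, comb c) (qx, dcomb c d)],
   whereas linearizing [Phi] at [(q, qx)] produces the right-hand side below. *)
Let dPhi_sym t x k kx : dPhi (q t x, k) (qx t x, kx) = dPhi (q t x, qx t x) (k, kx).
Proof.
have [P _] := Phi_C1.
have split u v (h l : V) : dPhi (u, v) (h, l) = dPhi (u, v) (h, 0) + df u l.
  have [PB _ _ _] := P (u, v).
  have hl : (h, 0) = (h, l) - (0, l) by rewrite -[RHS]/(h - 0, l - l) subr0 subrr.
  by rewrite -(dPhi_r u v l) hl PB subrK.
by rewrite split [RHS]split (second_diff_sym _ _ _ cV f_C1 Phi_C1).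
Qed.

(** A difference of values is a remainder in the full increment plus a linear term in the increment
    of [w] (and of [p]). Only the linear term has a constant that is not small; it comes from the
    ball of radius [M], so [K] is fixed before [eta]. *)
Lemma rhs_lipschitz : exists2 K : R, 0 < K & forall eta, 0 < eta ->
  exists2 r : R, 0 < r &
  (forall t x w w' c c' (a b : R),
    `|w| <= r -> `|w'| <= r -> `|c| <= r -> `|c'| <= r ->
    `|w - w'| <= a -> `|c - c'| <= b ->
    `|rhs1 t x w c - rhs1 t x w' c'| <= K * a + eta * b) /\
  (forall t x w w' p p' c c' d d' (a b : R),
    `|w| <= r -> `|w'| <= r -> `|p| <= r -> `|p'| <= r ->
    `|c| <= r -> `|c'| <= r -> `|d| <= r -> `|d'| <= r ->
    `|w - w'| <= a -> `|p - p'| <= a -> `|c - c'| <= b -> `|d - d'| <= b ->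
    `|rhs2 t x w p c d - rhs2 t x w' p' c' d'| <= K * a + eta * b).
Proof.
have cVV := compact_balls_pair cV cV.
have [K1 K10 HK1] := C1_map_lip cV f_C1 M.
have [K2 K20 HK2] := C1_map_lip cVV Phi_C1 M.
exists (K1 + K2 + 1); first by rewrite !addr_gt0.
move=> eta eta0; have N1 : 0 < N + 1 by rewrite ltr_pwDr.
(* [s * N <= eta] absorbs the contribution of [c], amplified by [N] in [comb]; [s <= 1] puts that of
   [w] into the last summand of [K1 + K2 + 1]. *)
pose s : R := Num.min 1 (eta / (N + 1)).
have s0 : 0 < s by rewrite lt_min ltr01 divr_gt0.
have s1 : s <= 1 by rewrite ge_min lexx.
have sN : s * N <= eta.
  apply: le_trans (_ : eta / (N + 1) * N <= _).
    by rewrite ler_wpM2r // ge_min lexx orbT.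
  rewrite mulrAC ler_pdivrMr // ler_wpM2l ?(ltW eta0) //; lra.
have [r1 r10 Hr1] := C1_map_remainder cV f_C1 M s0.
have [r2 r20 Hr2] := C1_map_remainder cVV Phi_C1 M s0.
(* An increment [comb + iota] has norm at most [N * r + r], which must stay within both radii of
   validity. *)
pose r : R := Num.min r1 r2 / (N + 1).
have r12 : N * r + r = Num.min r1 r2 by rewrite /r; field; rewrite gt_eqF.
have hr1 : N * r + r <= r1 by rewrite r12 ge_min lexx.
have hr2 : N * r + r <= r2 by rewrite r12 ge_min lexx orbT.
exists r; first by rewrite divr_gt0 // lt_min r10.
have fin (a b x1 x2 k : R) : 0 <= a -> 0 <= b -> k <= K1 + K2 ->
    x1 <= s * (N * b + a) -> x2 <= k * a -> x1 + x2 <= (K1 + K2 + 1) * a + eta * b.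
  move=> a0 b0 kK h1 h2; apply: le_trans (lerD h1 h2) _.
  have h3 : s * N * b <= eta * b by rewrite ler_wpM2r.
  have h4 : s * a <= a by rewrite ler_piMl.
  have h5 : k * a <= (K1 + K2) * a by rewrite ler_wpM2r.
  by lra.
split.
  move=> t x w w' c c' a b wr wr' cr cr' wa cb.
  have a0 : 0 <= a := le_trans (normr_ge0 _) wa.
  have b0 : 0 <= b := le_trans (normr_ge0 _) cb.
  set h := comb t x c + iota w; set h' := comb t x c' + iota w'.
  have [dB _ _ _] := f_C1.1 (q t x).
  have hh : h - h' = comb t x (c - c') + iota (w - w').
    by rewrite combB iotaB /h /h'; lmod_eq R.
  have -> : rhs1 t x w c - rhs1 t x w' c' =
     (f (q t x + h) - f (q t x + h') - df (q t x) (h - h')) + df (q t x) (iota (w - w')).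
    have -> : iota (w - w') = (h - h') - (comb t x c - comb t x c').
      by rewrite hh combB; lmod_eq R.
    by rewrite [X in _ = _ + X]dB [df _ (comb t x c - _)]dB /rhs1 -/h -/h'; lmod_eq R.
  have hle u v : `|u| <= r -> `|v| <= r -> `|comb t x u + iota v| <= r1.
    move=> ur vr; apply: le_trans (ler_normD _ _) _; apply: le_trans hr1.
    by apply: lerD; [exact: comb_le|exact: le_trans (iota_le _) _].
  apply: le_trans (ler_normD _ _) _; apply: (fin _ _ _ _ K1) => //.
  - by rewrite lerDl ltW.
  - apply: le_trans (Hr1 _ _ _ (qM t x) (hle _ _ cr wr) (hle _ _ cr' wr')) _.
    rewrite ler_pM2l // hh; apply: le_trans (ler_normD _ _) _.
    by apply: lerD; [exact: comb_le|exact: le_trans (iota_le _) _].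
  - apply: le_trans (HK1 _ _ (qM t x)) _; rewrite ler_pM2l //.
    exact: le_trans (iota_le _) _.
move=> t x w w' p p' c c' d d' a b wr wr' pr pr' cr cr' dr dr' wa pa cb db.
have a0 : 0 <= a := le_trans (normr_ge0 _) wa.
have b0 : 0 <= b := le_trans (normr_ge0 _) cb.
pose z := (q t x, qx t x).
pose h := (comb t x c + iota w, dcomb t x c d + iota p).
pose h' := (comb t x c' + iota w', dcomb t x c' d' + iota p').
have zM : `|z| <= M by rewrite pair_norm_le qM qxM.
have [dB _ _ _] := Phi_C1.1 z.
have hh : h - h' = (comb t x (c - c') + iota (w - w'),
    dcomb t x (c - c') (d - d') + iota (p - p')).
  rewrite combB dcombB !iotaB.
  rewrite -[LHS]/(comb t x c + iota w - (comb t x c' + iota w'),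
    dcomb t x c d + iota p - (dcomb t x c' d' + iota p')).
  by congr pair; lmod_eq R.
have -> : rhs2 t x w p c d - rhs2 t x w' p' c' d' =
    (Phi (z + h) - Phi (z + h') - dPhi z (h - h')) +
    dPhi z (iota (w - w'), iota (p - p')).
  have -> : (iota (w - w'), iota (p - p')) =
      (h - h') - ((comb t x c, dcomb t x c d) - (comb t x c', dcomb t x c' d')).
    rewrite hh combB dcombB.
    set i1 := iota (w - w'); set i2 := iota (p - p').
    rewrite -[RHS]/(comb t x c - comb t x c' + i1 - (comb t x c - comb t x c'),
      dcomb t x c d - dcomb t x c' d' + i2 - (dcomb t x c d - dcomb t x c' d')).
    by congr pair; lmod_eq R.
  have e1 : Phi (z + h) = df (q t x + (comb t x c + iota w))
    (qx t x + (dcomb t x c d + iota p)) by [].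
  have e2 : Phi (z + h') = df (q t x + (comb t x c' + iota w'))
    (qx t x + (dcomb t x c' d' + iota p')) by [].
  rewrite [X in _ = _ + X]dB [dPhi z (_ - (comb t x c', _))]dB e1 e2 /rhs2 -/z.
  set A1 := dPhi z (comb t x c, _); set A2 := dPhi z (comb t x c', _);
    set A3 := dPhi z (h - h'); lmod_eq R.
have hle u u' v v' : `|u| <= r -> `|u'| <= r -> `|v| <= r -> `|v'| <= r ->
    `|(comb t x u + iota v, dcomb t x u u' + iota v')| <= r2.
  move=> ur ur' vr vr'; apply: le_trans hr2; rewrite pair_norm_le /=; apply/andP; split.
    apply: le_trans (ler_normD _ _) _.
    by apply: lerD; [exact: comb_le|exact: le_trans (iota_le _) _].
  apply: le_trans (ler_normD _ _) _.
  by apply: lerD; [exact: dcomb_le|exact: le_trans (iota_le _) _].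
apply: le_trans (ler_normD _ _) _; apply: (fin _ _ _ _ K2) => //.
- by rewrite lerDr ltW.
- apply: le_trans (Hr2 _ _ _ zM (hle _ _ _ _ cr dr wr pr) (hle _ _ _ _ cr' dr' wr' pr')) _.
  rewrite ler_pM2l // hh pair_norm_le /=; apply/andP; split.
    apply: le_trans (ler_normD _ _) _.
    by apply: lerD; [exact: comb_le|exact: le_trans (iota_le _) _].
  apply: le_trans (ler_normD _ _) _.
  by apply: lerD; [exact: dcomb_le|exact: le_trans (iota_le _) _].
- apply: le_trans (HK2 _ _ zM) _; rewrite ler_pM2l // pair_norm_le /=.
  by apply/andP; split; exact: le_trans (iota_le _) _.
Qed.

Let iota_cont : continuous iota.
Proof.
move=> p; apply/cont_atP => eps eps0; exists eps => // p'; rewrite -iotaB.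
exact: le_lt_trans.
Qed.

Let coord_cont (c : R -> W) i : continuous c -> continuous (fun x => c x 0 i).
Proof.
move=> cc x; apply: (@continuous_comp _ _ _ c (fun v : W => v 0 i)); first exact: cc.
exact: coord_continuous.
Qed.

Let snd_coord_cont (c : R -> W) i : continuous c -> continuous (fun z : R * R => c z.2 0 i).
Proof.
move=> /(@coord_cont c i) cc z.
apply: (@continuous_comp _ _ _ snd (fun x => c x 0 i)); first exact: cvg_snd.
exact: cc.
Qed.

Let comb_cont c : continuous c -> jcont (fun t x => comb t x (c x)).
Proof.
move=> cc; apply: continuous_sum => i z.
by apply: cvgZ; [exact: snd_coord_cont|exact: e_cont].
Qed.

Let dcomb_cont c d : continuous c -> continuous d ->
  jcont (fun t x => dcomb t x (c x) (d x)).
Proof.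
move=> cc cd; apply: continuous_sum => i z.
by apply: cvgD; apply: cvgZ; [exact: snd_coord_cont|exact: ex_cont|
  exact: snd_coord_cont|exact: e_cont].
Qed.

Let f_cont : continuous f.
Proof. by move=> p; exact: frechet_cont (f_C1.1 p). Qed.

Let comp_cont (U U' : normedModType R) (g : U -> U') (h : R * R -> U) :
  continuous g -> continuous h -> continuous (fun z => g (h z)).
Proof. by move=> cg ch z; apply: continuous_comp; [exact: ch|exact: cg]. Qed.

Let comp2_cont (U U' U'' : normedModType R) (g : U -> U' -> U'') h h' :
  continuous (fun z : U * U' => g z.1 z.2) ->
  continuous (h : R * R -> U) -> continuous h' ->
  continuous (fun z : R * R => g (h z) (h' z)).
Proof.
move=> cg ch ch'.
apply: (@comp_cont _ _ (fun z : U * U' => g z.1 z.2) (fun z => (h z, h' z))) => //.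
by move=> z; apply: continuous_at_pair; [exact: ch|exact: ch'].
Qed.

Let shift_cont (U : normedModType R) (g k : R * R -> V) w :
  continuous g -> continuous k -> joint_cont w ->
  continuous (fun z => g z + (k z + iota (w z.1 z.2))).
Proof.
move=> cg ck cw z; apply: cvgD; first exact: cg.
apply: cvgD; first exact: ck.
exact: (comp_cont iota_cont cw).
Qed.

Lemma rhs_admissible : exists2 K : R, 0 < K & exists eta r : R,
  0 < r /\ admissible_rhs T L K eta r rhs1 rhs2.
Proof.
have [K K0 HK] := rhs_lipschitz; exists K => //.
have E0 : 0 < expR (4 * K * T) by exact: expR_gt0.
(* [T + 1] keeps the divisor positive, as [T] is only nonnegative here. *)
pose eta : R := Num.min 1 (4^-1 / ((T + 1) * expR (4 * K * T))).
have TE : 0 < (T + 1) * expR (4 * K * T) by rewrite mulr_gt0 // ltr_pwDr.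
have eta0 : 0 < eta by rewrite lt_min ltr01 divr_gt0.
have [r r0 [lip1 lip2]] := HK eta eta0.
exists eta, r; split=> //; split=> //.
- by rewrite ltW //= ge_min lexx.
- rewrite -mulrA; apply: le_trans (_ : eta * ((T + 1) * expR (4 * K * T)) <= _).
    by rewrite ler_pM2l // ler_pM2r // lerDl.
  by rewrite -ler_pdivlMr // ge_min lexx orbT.
- move=> w c cw cc z; have cs := shift_cont V q_cont (comb_cont cc) cw.
  apply: cvgB; first apply: cvgB.
  + exact: (comp_cont f_cont cs).
  + exact: (comp_cont f_cont q_cont).
  + exact: (comp2_cont f_C1.2 q_cont (comb_cont cc)).
- move=> w p c d cw cp cc cd z.
  apply: cvgB; first apply: cvgB.
  + exact: (comp2_cont f_C1.2 (shift_cont V q_cont (comb_cont cc) cw)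
      (shift_cont V qx_cont (dcomb_cont cc cd) cp)).
  + exact: (comp2_cont f_C1.2 q_cont qx_cont).
  + apply: (@comp2_cont _ _ _ dPhi (fun z => (q z.1 z.2, qx z.1 z.2))
      (fun z => (comb z.1 z.2 (c z.2), dcomb z.1 z.2 (c z.2) (d z.2))) Phi_C1.2) => z'.
      by apply: continuous_at_pair; [exact: q_cont|exact: qx_cont].
    by apply: (@continuous_at_pair _ _ _ (fun z => comb z.1 z.2 (c z.2))
      (fun z => dcomb z.1 z.2 (c z.2) (d z.2)));
      [exact: (comb_cont cc)|exact: (dcomb_cont cc cd)].
- move=> t x; rewrite /rhs1 comb0 iota0 !addr0 subrr (frechet0 (f_C1.1 _)) subr0 //.
- move=> t x; rewrite /rhs2 comb0 dcomb0 iota0 !addr0 subrr.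
  by rewrite (frechet0 (Phi_C1.1 _)) subr0.
- move=> t x w p c d wp cd.
  have combd : has_der setT (fun y => comb t y (c y)) x (dcomb t x (c x) d).
    apply: has_der_sum => i; apply: has_derZ; last exact: e_der.
    apply: (@has_der_lip _ _ _ _ c _ _ (fun v : W => v 0 i) 1) => //.
    + by move=> u v; rewrite !mxE.
    + by move=> a u; rewrite !mxE.
    + by move=> u; rewrite mul1r mx_coord_le.
  have iotad : has_der setT (fun y => iota (w y)) x (iota p).
    apply: (@has_der_lip _ _ _ _ w _ _ iota 1) => // u.
    by rewrite mul1r.
  apply: has_derB; first apply: has_derB.
  + exact: has_der_comp (f_C1.1 _) (has_derD (q_der t x) (has_derD combd iotad)).
  + exact: has_der_comp (f_C1.1 _) (q_der t x).
  + rewrite -dPhi_sym.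
    exact: (has_der_comp (Phi_C1.1 (q t x, comb t x (c x))) (has_der_pair (q_der t x) combd)).
- move=> t x; apply/funext => w; apply/funext => c; rewrite /rhs1 /comb q_per.
  by under eq_bigr do rewrite e_per.
- move=> t x; do 4 (apply/funext => ?); rewrite /rhs2 /comb /dcomb q_per qx_per.
  under eq_bigr do rewrite e_per; rewrite -!/(comb _ _ _).
  by under eq_bigr do rewrite e_per ex_per.
Qed.

End RemainderRhs.

(** * Norms and final assembly *)

Section Norms.
Context {R : realType} {W : normedModType R}.

Lemma sup_norm_ge (V : normedModType R) (A : set V) (u : V -> W) z :
  compact A -> {within A, continuous u} -> A z -> `|u z| <= sup_norm A u.
Proof.
move=> cA cu Az; have [M _ HM] := compact_bound cA cu.
by apply: ub_le_sup; [exists M => _ [x Ax <-]; exact: HM | exists z].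
Qed.

Lemma sup_norm_le (U : Type) (A : set U) (u : U -> W) (M : R) :
  A !=set0 -> (forall z, A z -> `|u z| <= M) -> sup_norm A u <= M.
Proof.
move=> [z Az] uM; apply: ge_sup; first by exists `|u z|; exists z.
by move=> _ [x Ax <-]; exact: uM.
Qed.

Context (L : R) (L0 : 0 < L).

Lemma C1per_seg_der (g : R -> W) x : C1per_seg L g -> x \in `[0, L] ->
  has_der `[0, L] g x (seg_derive L g x).
Proof. by move=> [[_ dg _] _ _] xL; apply: seg_has_der => //; exact: dg. Qed.

Lemma has_der_C1per_seg (g dg : R -> W) : {within `[0, L], continuous g} ->
  {within `[0, L], continuous dg} ->
  (forall x, x \in `[0, L] -> has_der `[0, L] g x (dg x)) ->
  g 0 = g L -> dg 0 = dg L ->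
  C1per_seg L g /\ forall x, x \in `[0, L] -> seg_derive L g x = dg x.
Proof.
move=> cg cdg gdg g0L dg0L.
have D x : x \in `[0, L] -> seg_derive L g x = dg x.
  by move=> xL; have [] := has_der_seg L0 xL (gdg x xL).
split=> //; split=> //.
  split=> //.
    by move=> x xL; have [] := has_der_seg L0 xL (gdg x xL).
  apply/within_contP => x xL e e0; move/within_contP: cdg => /(_ x xL e e0)[d d0 H].
  by exists d => // y yL yx; rewrite !D //; apply: H.
by rewrite !D // in_itv /= lexx ltW.
Qed.

Lemma C1per_seg_cst (v : W) : C1per_seg L (fun=> v).
Proof.
apply: (has_der_C1per_seg (dg := fun=> 0) _ _ _ _ _).1 => //.
- by apply/within_contP => p _ e e0; exists 1 => // q _ _; rewrite subrr normr0.
- by apply/within_contP => p _ e e0; exists 1 => // q _ _; rewrite subrr normr0.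
- by move=> x _; exact: has_der_cst.
Qed.

Lemma C1per_segB (g h : R -> W) : C1per_seg L g -> C1per_seg L h ->
  C1per_seg L (fun x => g x - h x).
Proof.
move=> Hg Hh; have [[cg _ cdg] g0L dg0L] := Hg; have [[ch _ cdh] h0L dh0L] := Hh.
apply: (has_der_C1per_seg (dg := fun x => seg_derive L g x - seg_derive L h x) _ _ _ _ _).1.
- by move=> x; apply: cvgB; [exact: cg|exact: ch].
- by move=> x; apply: cvgB; [exact: cdg|exact: cdh].
- by move=> x xL; apply: has_derB; exact: C1per_seg_der.
- by rewrite g0L h0L.
- by rewrite dg0L dh0L.
Qed.

Lemma C1per_seg_bound (g : R -> W) (mu : R) x : C1per_seg L g ->
  C1norm_seg L g <= mu -> x \in `[0, L] ->
  `|g x| <= mu /\ `|seg_derive L g x| <= mu.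
Proof.
move=> [[cg _ cdg] _ _]; rewrite /C1norm_seg ge_max => /andP[g1 g2] xL.
split; [apply: le_trans g1|apply: le_trans g2].
  exact: (sup_norm_ge (segment_compact (a := 0) (b := L)) cg).
exact: (sup_norm_ge (segment_compact (a := 0) (b := L)) cdg).
Qed.

Lemma C1per_rect_slice T (y : R * R -> W) t : t \in `[0, T] -> C1per_rect T L y ->
  C1per_seg L (fun x => y (t, x)).
Proof.
move=> tT [[cy dery cty cxy] per]; have [y0 y1] := per t tT.
have slice (u : R * R -> W) : {within rect T L, continuous u} ->
    {within `[0, L], continuous (fun x => u (t, x))}.
  move=> /within_contP cu; apply/within_contP => x xL e e0.
  have [d d0 H] := cu (t, x) (conj tT xL) e e0; exists d => // x' x'L xx.
  by apply: H; [split | rewrite pair_norm_lt /= subrr normr0 d0].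
split=> //; split; [exact: slice| |exact: (slice (dx L y))].
by move=> x xL; case: (dery t x (conj tT xL)).
Qed.

Lemma C1norm_rect_le T (y yt yx : R * R -> W) (M : R) : 0 < T ->
  C1_data T L y yt yx ->
  (forall z, rect T L z -> [/\ `|y z| <= M, `|yt z| <= M & `|yx z| <= M]) ->
  C1norm_rect T L y <= M.
Proof.
move=> T0 D H; have [_ E] := data_C1per T0 L0 D.
have ne : rect T L !=set0.
  by exists (0, 0); split; rewrite /= in_itv /= lexx ltW.
rewrite /C1norm_rect !ge_max; apply/and3P; split; apply: sup_norm_le => // z zr.
- by case: (H z zr).
- by rewrite (E z zr).1; case: (H z zr).
- by rewrite (E z zr).2; case: (H z zr).
Qed.

Lemma C1_data_bound T (y yt yx : R * R -> W) : C1_data T L y yt yx ->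
  exists2 M : R, 0 < M &
    forall z, rect T L z -> [/\ `|y z| <= M, `|yt z| <= M & `|yx z| <= M].
Proof.
move=> [cy ct cx _ _ _].
have cr : compact (rect T L) by apply: compact_setX; exact: segment_compact.
have [M1 M10 H1] := compact_bound cr cy; have [M2 M20 H2] := compact_bound cr ct.
have [M3 M30 H3] := compact_bound cr cx.
exists (M1 + M2 + M3); first by rewrite !addr_gt0.
move=> z zr; have := H1 z zr; have := H2 z zr; have := H3 z zr => h3 h2 h1.
by split; lra.
Qed.

(** The extension of functions on the rectangle is reused, with a dummy time interval [[0, 1]] read
    at time 0. *)
Lemma periodic_extension_seg (g : R -> W) : C1per_seg L g -> exists G dG : R -> W,
  [/\ forall x, has_der setT G x (dG x), continuous dG,
      forall x, x \in `[0, L] -> G x = g x,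
      forall x, G (x + L) = G x /\ dG (x + L) = dG x &
      forall mu, (forall x, x \in `[0, L] -> `|g x| <= mu /\ `|seg_derive L g x| <= mu) ->
        forall x, `|G x| <= mu /\ `|dG x| <= mu].
Proof.
move=> Hg; have [[cg _ cdg] g0L dg0L] := Hg.
have snd_cont (u : R -> W) : {within `[0, L], continuous u} ->
    {within rect 1 L, continuous (fun z : R * R => u z.2)}.
  move=> /within_contP cu; apply/within_contP => z [_ zL] e e0.
  have [d d0 H] := cu z.2 zL e e0; exists d => // z' [_ z'L].
  by rewrite pair_norm_lt => /andP[_ zz]; apply: H.
exists (pext L 1 (fun z => g z.2) 0), (pext L 1 (fun z => seg_derive L g z.2) 0).
split.
- move=> x; apply: pext_der => //.
  by move=> z [_ zL]; apply: C1per_seg_der.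
- have := pext_cont L0 ltr01 (snd_cont _ cdg) (fun _ _ => dg0L).
  exact: (@joint_cont_r _ _ _ 0).
- move=> x xL; rewrite (pext_id L0) //; split=> //=.
  by rewrite in_itv /= lexx ler01.
- by move=> x; rewrite !pext_per.
- move=> mu H x; have /andP[p0 pL] := pmod_itv L0 x.
  by apply: H; rewrite in_itv /= p0 ltW.
Qed.

End Norms.

Section Assembly.
Context {R : realType}.

Lemma C1_data_pair (U V : normedModType R) (T L : R) (y yt yx : R * R -> U)
    (z zt zx : R * R -> V) : C1_data T L y yt yx -> C1_data T L z zt zx ->
  C1_data T L (fun p => (y p, z p)) (fun p => (yt p, zt p)) (fun p => (yx p, zx p)).
Proof.
move=> [cy ct cx dert derx per] [cy' ct' cx' dert' derx' per']; split.
- by move=> p; apply: continuous_at_pair; [exact: cy|exact: cy'].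
- by move=> p; apply: continuous_at_pair; [exact: ct|exact: ct'].
- by move=> p; apply: continuous_at_pair; [exact: cx|exact: cx'].
- by move=> p pr; apply: has_der_pair; [exact: dert|exact: dert'].
- by move=> p pr; apply: has_der_pair; [exact: derx|exact: derx'].
- by move=> t tT; have [-> ->] := per t tT; have [-> ->] := per' t tT.
Qed.

Lemma has_der_shift (W : normedModType R) (g : R -> W) (x s : R) v :
  has_der setT g (x + s) v -> has_der setT (fun y => g (y + s)) x v.
Proof.
move=> gv e /gv[d d0 H]; exists d => // y _ yx.
have := H (y + s) I; rewrite (_ : y + s - (x + s) = y - x); last by ring.
exact.
Qed.

(** For [t] in [[0, T]], [q t xi] is [u] at [(t, xi + t)] with space read modulo [L]. All its values
    are values of [u] on the rectangle, so bounds carry over. *)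
Lemma characteristic_data (W : normedModType R) (T L : R) (u ut ux : R * R -> W) :
  0 < T -> 0 < L -> C1_data T L u ut ux -> exists q qx : R -> R -> W,
  [/\ joint_cont q, joint_cont qx, forall t x, has_der setT (q t) x (qx t x),
      forall t x, q t (x + L) = q t x /\ qx t (x + L) = qx t x &
      (forall M, (forall z, rect T L z -> `|u z| <= M /\ `|ux z| <= M) ->
        forall t x, `|q t x| <= M /\ `|qx t x| <= M) /\
      forall z, rect T L z -> q z.1 (z.2 - z.1) = u z].
Proof.
move=> T0 L0 [cu _ cux _ derx per].
have uper t : t \in `[0, T] -> u (t, 0) = u (t, L) by case/per.
have uxper t : t \in `[0, T] -> ux (t, 0) = ux (t, L) by case/per.
have shift (g : R -> R -> W) : joint_cont g -> joint_cont (fun t x => g t (x + clamp T t)).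
  move=> cg z; apply: (@continuous_comp _ _ _ (fun z : R * R => (z.1, z.2 + clamp T z.1))
    (fun z : R * R => g z.1 z.2)); last exact: cg.
  apply: continuous_at_pair; first exact: cvg_fst.
  apply: cvgD; first exact: cvg_snd.
  by apply: (@continuous_comp _ _ _ fst (clamp T)); [exact: cvg_fst|exact: continuous_clamp].
exists (fun t x => pext L T u t (x + clamp T t)), (fun t x => pext L T ux t (x + clamp T t)).
split.
- exact: shift (pext_cont L0 T0 cu uper).
- exact: shift (pext_cont L0 T0 cux uxper).
- by move=> t x; apply: has_der_shift; apply: pext_der.
- by move=> t x; rewrite addrAC !pext_per.
- split.
    move=> M uM t x; apply: uM; split=> /=; first by apply: clamp_in; exact: ltW.
    by have /andP[p0 pL] := pmod_itv L0 (x + clamp T t); rewrite in_itv /= p0 ltW.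
  move=> [t x] zr; have [/= tT _] := zr.
  by rewrite clamp_id // subrK (pext_id L0).
Qed.

(** Together with [df_dThetaE], this merges the two partial differentials of the linearized equation
    into the differential of [f] applied to the pair of state and control. *)
Lemma df_dyE n m (f : 'rV[R]_n * 'rV[R]_m -> 'rV[R]_n) u th v :
  differentiable f (u, th) -> df_dy f u th v = 'd f (u, th) (v, 0).
Proof.
move=> dff; rewrite /df_dy -[fun u' => _]/(f \o (fun u' => (u', th))).
by rewrite diff_comp //= diff_pair // diff_cst diff_val.
Qed.

Lemma df_dThetaE n m (f : 'rV[R]_n * 'rV[R]_m -> 'rV[R]_n) u th v :
  differentiable f (u, th) -> df_dTheta f u th v = 'd f (u, th) (0, v).
Proof.
move=> dff; rewrite /df_dTheta -[fun u' => _]/(f \o (fun th' => (u, th'))).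
by rewrite diff_comp //= diff_pair // diff_cst diff_val.
Qed.

(** The target rectangle is closed, so it contains the closure as soon as it contains the set. *)
Lemma supported_inP (W : normedModType R) (T L a b : R) (y : R * R -> W) :
  supported_in T L a b y <->
  forall z, rect T L z -> y z != 0 -> z.2 \in `[a, b].
Proof.
split=> [H z zr y0|H].
  by have [] : (`[0, T] `*` `[a, b]) z by apply: H; apply: subset_closure.
have cl : closed (`[0, T] `*` `[a, b] : set (R * R)).
  apply: (@closedI _ (fst @^-1` `[0, T]) (snd @^-1` `[a, b]));
    apply: closed_comp => [z _|]; try exact: itv_closed.
    exact: cvg_fst.
  exact: cvg_snd.
rewrite /supported_in [X in _ `<=` X](closure_id _).1 //.
by apply: closure_subset => z [zr y0]; split; [case: zr|exact: H].
Qed.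

Lemma sum_pair (U V : normedModType R) (I : finType) (g : I -> U) (h : I -> V) (c : I -> R) :
  \sum_i c i *: (g i, h i) = (\sum_i c i *: g i, \sum_i c i *: h i).
Proof.
by elim/big_rec3 : _ => // i x1 x2 x3 _ ->.
Qed.

Lemma ler_bigsum (I : finType) (F : I -> R) i : (forall j, 0 <= F j) -> F i <= \sum_j F j.
Proof. by move=> F0; rewrite (bigD1 i) //= lerDl sumr_ge0. Qed.

End Assembly.

Theorem theorem2p9 (R : realType) (n m : nat) (hn : (0 < n)%N) (hm : (0 < m)%N)
    (T L a b : R) (hT : 0 < T) (hL : 0 < L) (ha : 0 <= a) (hab : a < b)
    (hb : b <= L)
    (f : 'rV[R]_n * 'rV[R]_m -> 'rV[R]_n) (hf : class_C2 f)
    (ytilde : R * R -> 'rV[R]_n) (Thetatilde : R * R -> 'rV[R]_m)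
    (htraj : trajectory T L a b f ytilde Thetatilde)
    (hlin : linearized_exactly_controllable T L a b f ytilde Thetatilde) :
  locally_exactly_controllable T L a b f ytilde Thetatilde.
Proof.
pose V : normedModType R := ('rV[R]_n * 'rV[R]_m)%type.
have bc := coordinates_pair (@coordinates_rV R n) (@coordinates_rV R m).
have f_C1 : C1_map f (fun p => 'd f p) := class_C1_map bc hf.1.
have [dPhi [Phi_C1 dPhi_r]] := class_C2_tangent bc hf.
have cV : compact_balls V := compact_balls_pair (@compact_balls_rV R n) (@compact_balls_rV R m).
have [[Th_per Th_supp] [y0t y0t_per [yt_per yt_eq yt_bd yt_init]]] := htraj.

(* Linear controls steering to the basis vectors *)
have /choice[cy Hcy] (i : 'I_n) : exists cy : (R * R -> 'rV[R]_m) * (R * R -> 'rV[R]_n),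
  [/\ admissible_control T L a b cy.1,
      solution_linearized T L f ytilde Thetatilde cy.1 (fun=> 0) cy.2 &
      {in `[0, L], forall x, cy.2 (T, x) = 'e_i}].
  have [Th [y [h1 h2 h3]]] := hlin _ _ (C1per_seg_cst hL (0 : 'rV[R]_n))
    (C1per_seg_cst hL ('e_i : 'rV[R]_n)).
  by exists (Th, y).
pose Th_ i := (cy i).1; pose y_ i := (cy i).2.
have Dy := C1per_data hT hL yt_per; have DTh := C1per_data hT hL Th_per.
have Dy_ i : C1_data T L (y_ i) (dt T (y_ i)) (dx L (y_ i)).
  by have [_ [per _ _ _] _] := Hcy i; exact: C1per_data.
have DTh_ i : C1_data T L (Th_ i) (dt T (Th_ i)) (dx L (Th_ i)).
  by have [[per _] _ _] := Hcy i; exact: C1per_data.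
have DQ := C1_data_pair Dy DTh; have DE i := C1_data_pair (Dy_ i) (DTh_ i).

(* The trajectory and the linear solutions along characteristics *)
have [q [qx [q_cont qx_cont q_der q_per [qM q_eq]]]] := characteristic_data hT hL DQ.
have /choice[ee Hee] (i : 'I_n) : exists ee : (R -> R -> V) * (R -> R -> V),
  [/\ joint_cont ee.1, joint_cont ee.2, forall t x, has_der setT (ee.1 t) x (ee.2 t x),
      forall t x, ee.1 t (x + L) = ee.1 t x /\ ee.2 t (x + L) = ee.2 t x &
      (forall M, (forall z, rect T L z -> `|((y_ i z, Th_ i z) : V)| <= M /\
          `|((dx L (y_ i) z, dx L (Th_ i) z) : V)| <= M) ->
        forall t x, `|ee.1 t x| <= M /\ `|ee.2 t x| <= M) /\
      forall z, rect T L z -> ee.1 z.1 (z.2 - z.1) = (y_ i z, Th_ i z)].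
  have [e [ex He]] := characteristic_data hT hL (DE i).
  by exists (e, ex).
have [M0 M00 HM0] := C1_data_bound DQ.
have /choice[M_ HM_] (i : 'I_n) : exists M : R, 0 < M /\ forall z, rect T L z ->
  [/\ `|((y_ i z, Th_ i z) : V)| <= M,
      `|((dt T (y_ i) z, dt T (Th_ i) z) : V)| <= M &
      `|((dx L (y_ i) z, dx L (Th_ i) z) : V)| <= M].
  by have [M M_0 HM] := C1_data_bound (DE i); exists M.
pose M := M0 + \sum_i M_ i.
have M_ge0 i : 0 <= M_ i by have [/ltW] := HM_ i.
have M_le i : M_ i <= M.
  by apply: le_trans (ler_bigsum i M_ge0) _; rewrite lerDr ltW.
have M0_le : M0 <= M by rewrite lerDl sumr_ge0.
have M_ge00 : 0 <= M := le_trans (ltW M00) M0_le.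
pose iota (w : 'rV[R]_n) : V := (w, 0).
have iotaB x y : iota (x - y) = iota x - iota y.
  by rewrite -[RHS]/(x - y, 0 - 0) subrr.
have iotaZ (c : R) x : iota (c *: x) = c *: iota x.
  by rewrite -[RHS]/(c *: x, c *: 0) scaler0.
have iota_le x : `|iota x| <= `|x| by rewrite pair_norm_le /= normr0 lexx /=.
have qM' := qM M _; have {}qM' t x : `|q t x| <= M /\ `|qx t x| <= M.
  by apply: qM' => z /HM0[h1 _ h2]; split; [apply: le_trans h1 _|apply: le_trans h2 _].
have eM i t x : `|(ee i).1 t x| <= M /\ `|(ee i).2 t x| <= M.
  have [_ _ _ _ [H _]] := Hee i.
  apply: H => z; have [_ H] := HM_ i => /H[h1 _ h2].
  by split; [apply: le_trans h1 _|apply: le_trans h2 _].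
have e_cont i : joint_cont (ee i).1 by have [h _ _ _ _] := Hee i.
have ex_cont i : joint_cont (ee i).2 by have [_ h _ _ _] := Hee i.
have e_der i t x : has_der setT ((ee i).1 t) x ((ee i).2 t x).
  by have [_ _ h _ _] := Hee i.
have e_per i t x : (ee i).1 t (x + L) = (ee i).1 t x.
  by have [_ _ _ h _] := Hee i; have [] := h t x.
have ex_per i t x : (ee i).2 t (x + L) = (ee i).2 t x.
  by have [_ _ _ h _] := Hee i; have [] := h t x.
have e_eq i z : rect T L z -> (ee i).1 z.1 (z.2 - z.1) = (y_ i z, Th_ i z).
  by have [_ _ _ _ [_ h]] := Hee i; exact: h.
have [K K0 [eta [r [r0 Hadm]]]] := @rhs_admissible _ _ _ f (fun p => 'd f p) dPhi cV
  f_C1 Phi_C1 dPhi_r iota iotaB iotaZ iota_le T L M (ltW hT) M_ge00 q qx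
  (fun i => (ee i).1) (fun i => (ee i).2) q_cont qx_cont e_cont ex_cont q_der e_der
  (fun t x => (qM' t x).1) (fun t x => (qM' t x).2)
  (fun i t x => (eM i t x).1) (fun i t x => (eM i t x).2)
  (fun t x => (q_per t x).1) (fun t x => (q_per t x).2) e_per ex_per.
set H1 := rhs1 _ _ _ _ _ in Hadm; set H2 := rhs2 _ _ _ _ _ _ _ in Hadm.
(* [A] and [N] make [rho] bound [w], [c] and their derivatives, and
   [N * rho] bound the perturbations of the state and of the control. *)
move=> eps eps0.
pose E := expR (4 * K * T).
have E0 : 0 < E by exact: expR_gt0.
pose A : R := 1 + 2 * (1 + T) * E.
have A0 : 0 < A by rewrite addr_gt0 // !mulr_gt0 // addr_gt0.
pose N : R := 2 * M * n%:R + K + 3.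
have N0 : 0 < N by rewrite ltr_pwDr // addr_ge0 ?(ltW K0) // !mulr_ge0.
pose rho : R := Num.min r (eps / N).
have rho0 : 0 < rho by rewrite lt_min r0 divr_gt0.
have Nrho : N * rho <= eps by rewrite mulrC -ler_pdivlMr // ge_min lexx orbT.
have rho_r : rho <= r by rewrite ge_min lexx.
exists (rho / A) => [|y0 y1 Hy0 Hy1 n0 n1]; first by rewrite divr_gt0.
have mu0 : 0 <= rho / A by rewrite ltW // divr_gt0.

(* Errors on the data, and the two-point problem *)
have in0 : 0 \in `[0, T] by rewrite in_itv /= lexx ltW.
have inT : T \in `[0, T] by rewrite in_itv /= lexx ltW.
have [D0 [dD0 [D0_der dD0_cont D0_eq D0_per D0_mu]]] :=
  periodic_extension_seg hL (C1per_segB hL Hy0 (C1per_rect_slice in0 yt_per)).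
have [D1 [dD1 [D1_der dD1_cont D1_eq D1_per D1_mu]]] :=
  periodic_extension_seg hL (C1per_segB hL Hy1 (C1per_rect_slice inT yt_per)).
have {}D0_mu := D0_mu _ (fun x => C1per_seg_bound
  (C1per_segB hL Hy0 (C1per_rect_slice in0 yt_per)) n0).
have {}D1_mu := D1_mu _ (fun x => C1per_seg_bound
  (C1per_segB hL Hy1 (C1per_rect_slice inT yt_per)) n1).
(* The characteristic reaching [x] at time [T] carries the label [x - T], so the terminal error is
   shifted by [T]. *)
pose d1 x := D1 (x + T); pose dd1 x := dD1 (x + T).
have muA : rho / A + 2 * (rho / A * (1 + T)) * E = rho.
  by rewrite /A; field; rewrite gt_eqF.
have C_rho : 2 * (rho / A * (1 + T)) * E <= rho by rewrite -[leRHS]muA lerDr.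
have [w [p [w_cont p_cont w_der [w_dert w_init wp_le wp_per]]]] :
  exists w p : R -> R -> 'rV[R]_n,
  [/\ joint_cont w, joint_cont p,
      forall t x, has_der setT (w t) x (p t x) &
      [/\ forall t x, t \in `[0, T] ->
            has_der `[0, T] (w^~ x) t (H1 t x (w t x) (d1 x - w T x)),
          forall x, w 0 x = D0 x,
          forall t x, `|w t x| <= 2 * (rho / A * (1 + T)) * E /\
            `|p t x| <= 2 * (rho / A * (1 + T)) * E &
          forall t x, w t (x + L) = w t x /\ p t (x + L) = p t x]].
  apply: (two_point_problem (mu := rho / A) (dd0 := dD0) (dd1 := dd1) Hadm).
  - exact: D0_der.
  - by move=> x; exact: has_der_shift.
  - exact: dD0_cont.
  - move=> x; apply: (@continuous_comp _ _ _ (fun x => x + T) dD1); last exact: dD1_cont.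
    by apply: cvgD; [exact: cvg_id|exact: cvg_cst].
  - by move=> x; have [? ?] := D0_mu x; have [? ?] := D1_mu (x + T); split.
  - move=> x; have [? ?] := D0_per x; have [? ?] := D1_per (x + T).
    by rewrite /d1 /dd1 addrAC; split.
  - by rewrite muA.
pose c x := d1 x - w T x; pose dc x := dd1 x - p T x.
have w_le t x : `|w t x| <= rho by apply: le_trans (wp_le t x).1 C_rho.
have p_le t x : `|p t x| <= rho by apply: le_trans (wp_le t x).2 C_rho.
have c_le x : `|c x| <= rho.
  rewrite -muA; apply: le_trans (ler_normB _ _) _.
  by apply: lerD; [exact: (D1_mu _).1|exact: (wp_le T x).1].
have dc_le x : `|dc x| <= rho.
  rewrite -muA; apply: le_trans (ler_normB _ _) _.
  by apply: lerD; [exact: (D1_mu _).2|exact: (wp_le T x).2].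
have c_der x : has_der setT c x (dc x).
  by apply: has_derB; [exact: has_der_shift|exact: w_der].
have c_cont : continuous c by move=> x; exact: continuous_has_der (c_der x).
have dc_cont : continuous dc.
  move=> x; apply: cvgB; last exact: joint_cont_r p_cont x.
  apply: (@continuous_comp _ _ _ (fun x => x + T) dD1); last exact: dD1_cont.
  by apply: cvgD; [exact: cvg_id|exact: cvg_cst].
have c_per x : c (x + L) = c x.
  by rewrite /c /d1 addrAC (D1_per _).1 (wp_per _ _).1.
have dc_per x : dc (x + L) = dc x.
  by rewrite /dc /dd1 addrAC (D1_per _).2 (wp_per _ _).2.
pose wt t x := H1 t x (w t x) (c x).
have wt_cont : joint_cont wt := rhs_cont1 Hadm w_cont c_cont.
have wt_le t x : `|wt t x| <= (K + 1) * rho.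
  have z0 : `|0 : 'rV[R]_n| <= r by rewrite normr0 ltW.
  have -> : wt t x = H1 t x (w t x) (c x) - H1 t x 0 0.
    by rewrite (rhs01 Hadm) subr0.
  apply: le_trans (rhs_lip1 Hadm (a := rho) (b := rho) _ _ _ z0 _ z0 _ _) _.
  - exact: le_trans (w_le t x) rho_r.
  - exact: le_trans (c_le x) rho_r.
  - by rewrite subr0.
  - by rewrite subr0.
  - rewrite mulrDl lerD2l ler_pM2r //.
    by have /andP[] := rhs_eta Hadm.

(* The perturbations of the state and of the control *)
have Dw := transport_data w_cont p_cont wt_cont w_der w_dert wp_per.
pose k i (z : R * R) : R := c (z.2 - z.1) 0 i.
pose kx i (z : R * R) : R := dc (z.2 - z.1) 0 i.
have coord_cont (g : R -> 'rV[R]_n) i : continuous g ->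
    continuous (fun z : R * R => g z.2 0 i).
  move=> cg z; apply: (@continuous_comp _ _ _ snd (fun x => g x 0 i)); first exact: cvg_snd.
  apply: (@continuous_comp _ _ _ g (fun v => v 0 i)); first exact: cg.
  exact: coord_continuous.
(* A function of [x - t] has zero derivative along characteristics, so its time derivative is the
   opposite of its space derivative. *)
have Dk i : C1_data T L (k i) (fun z => 0 - kx i z) (kx i).
  apply: (transport_data (w := fun _ x => c x 0 i) (p := fun _ x => dc x 0 i)
    (wt := fun _ _ => 0)).
  - exact: coord_cont.
  - exact: coord_cont.
  - exact: cst_continuous.
  - move=> t x; apply: (@has_der_lip _ _ _ _ c _ _ (fun v : 'rV[R]_n => v 0 i) 1) => //.
    + by move=> u v; rewrite !mxE.
    + by move=> s u; rewrite !mxE.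
    + by move=> u; rewrite mul1r mx_coord_le.
  - by move=> t x _; exact: has_der_cst.
  - by move=> t x; rewrite c_per dc_per.
have DdY := C1_dataD (C1_data_sum (fun i => C1_data_scale (Dk i) (Dy_ i))) Dw.
have DdTh := C1_data_sum (fun i => C1_data_scale (Dk i) (DTh_ i)).
have DY := C1_dataD Dy DdY; have DT := C1_dataD DTh DdTh.
set dY := (fun z : R * R => _ + w _ _) in DdY DY.
set dTh := (fun z : R * R => \sum_i k i z *: Th_ i z) in DdTh DT.
have [Y_per Y_der] := data_C1per hT hL DY.
have [T_per _] := data_C1per hT hL DT.
have comb_le (W : normedModType R) (g h : 'I_n -> W) z :
    (forall i, `|g i| <= M) -> (forall i, `|h i| <= M) ->
    `|\sum_i (k i z *: g i + kx i z *: h i)| <= 2 * M * n%:R * rho.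
  by move=> gM hM; apply: norm_comb_le.
exists (fun z => Thetatilde z + dTh z), (fun z => ytilde z + dY z).
have y_M i z : rect T L z ->
    [/\ `|y_ i z| <= M, `|dt T (y_ i) z| <= M & `|dx L (y_ i) z| <= M] /\
    [/\ `|Th_ i z| <= M, `|dt T (Th_ i) z| <= M & `|dx L (Th_ i) z| <= M].
  move=> zr; have [_ /(_ z zr)[h1 h2 h3]] := HM_ i.
  have LM (u : 'rV[R]_n) (v : 'rV[R]_m) : `|((u, v) : V)| <= M_ i -> `|u| <= M /\ `|v| <= M.
    move=> uv; have := le_trans uv (M_le i).
    by rewrite (@pair_norm_le R _ _ (u, v)) => /andP.
  have [a1 b1] := LM _ _ h1; have [a2 b2] := LM _ _ h2; have [a3 b3] := LM _ _ h3.
  exact: (conj (And3 a1 a2 a3) (And3 b1 b2 b3)).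
have bound3 (x : R) : x <= 2 * M * n%:R * rho + (K + 2) * rho -> x <= eps.
  move=> xN; apply: le_trans Nrho; apply: le_trans xN _.
  rewrite -mulrDl ler_pM2r // /N -addrA !lerD2l.
  by rewrite lerDl.
have comb0_le (W : normedModType R) (g : 'I_n -> W) z :
    (forall i, `|g i| <= M) -> `|\sum_i k i z *: g i| <= 2 * M * n%:R * rho.
  move=> gM; rewrite (eq_bigr (fun i => k i z *: g i + (0 : 'rV[R]_n) 0 i *: g i)).
    by apply: norm_comb_le => //; rewrite normr0 ltW.
  by move=> i _; rewrite mxE scale0r addr0.
have combN_le (W : normedModType R) (g h : 'I_n -> W) z :
    (forall i, `|g i| <= M) -> (forall i, `|h i| <= M) ->
    `|\sum_i (k i z *: g i + (0 - kx i z) *: h i)| <= 2 * M * n%:R * rho.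
  move=> gM hM; rewrite (eq_bigr (fun i => k i z *: g i + kx i z *: (- h i))).
    by apply: comb_le => // i; rewrite normrN.
  by move=> i _; rewrite sub0r scaleNr scalerN.
have K2 : 1 <= K + 2 by rewrite -[leLHS]add0r lerD ?(ltW K0) // ler1n.
have rho_K : rho <= (K + 2) * rho by rewrite ler_peMl ?(ltW rho0).
have E_eq i z : rect T L z -> dt T (y_ i) z + dx L (y_ i) z =
    'd f (ytilde z, Thetatilde z) (y_ i z, Th_ i z).
  move=> zr; have [_ [_ /(_ z zr) -> _ _] _] := Hcy i.
  have df : differentiable f (ytilde z, Thetatilde z) by case: hf => -[].
  rewrite df_dyE // df_dThetaE // -linearD; congr ('d f _ _).
  by rewrite -[LHS]/(_ + 0, 0 + _) addr0 add0r.

(* Verification of the five conclusions *)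
split.
- split; first exact: T_per.
  apply/supported_inP => z zr; have [zab|zab] := boolP (z.2 \in `[a, b]) => //.
  (* Off [[a, b]] the control [Thetatilde] and all the [Th_ i] vanish, hence so does the
     combination. *)
  have Th0 (S : R * R -> 'rV[R]_m) : supported_in T L a b S -> S z = 0.
    by move=> /supported_inP/(_ z zr) H; apply/eqP/negPn/negP => /H; apply/negP.
  rewrite Th0 // /dTh big1 ?addr0 ?eqxx // => i _.
  by have [[_ /Th0 Thi0] _ _] := Hcy i; rewrite [Th_ i z]Thi0 scaler0.
- split.
  + exact: Y_per.
  + move=> z zr; have [-> ->] := Y_der z zr.
    pose xi := z.2 - z.1.
    have qE : q z.1 xi = (ytilde z, Thetatilde z) by exact: q_eq.
    have cE : comb (fun i => (ee i).1) z.1 xi (c xi) =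
        (\sum_i k i z *: y_ i z, \sum_i k i z *: Th_ i z).
      by rewrite -sum_pair; apply: eq_bigr => i _; rewrite e_eq.
    have wtE : wt z.1 xi = f (ytilde z + dY z, Thetatilde z + dTh z)
       - f (ytilde z, Thetatilde z)
       - 'd f (ytilde z, Thetatilde z) (\sum_i k i z *: (y_ i z, Th_ i z)).
      rewrite /wt /H1 /rhs1 qE cE sum_pair; congr (f _ - _ - _).
      by rewrite -[LHS]/(_ + (_ + _), _ + (_ + 0)) addr0.
    have S : \sum_i k i z *: (dt T (y_ i) z + dx L (y_ i) z) =
        'd f (ytilde z, Thetatilde z) (\sum_i k i z *: (y_ i z, Th_ i z)).
      by rewrite linear_sum; apply: eq_bigr => i _; rewrite E_eq // linearZ.
    (* The derivatives of the coefficients cancel because [k i] is constant along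
       characteristics. *)
    have S' : \sum_i (k i z *: dt T (y_ i) z + (0 - kx i z) *: y_ i z) +
        \sum_i (k i z *: dx L (y_ i) z + kx i z *: y_ i z) =
        \sum_i k i z *: (dt T (y_ i) z + dx L (y_ i) z).
      rewrite -big_split; apply: eq_bigr => i _.
      by rewrite sub0r scaleNr scalerDr [LHS]addrACA addNr addr0.
    rewrite -/xi wtE -S -S' -[f (ytilde z, Thetatilde z)]yt_eq //.
    rewrite -[RHS]/(f (ytilde z + dY z, Thetatilde z + dTh z)).
    set F := f _; set s1 := \sum_i _; set s2 := \sum_i _; set P := p _ _.
    by lmod_eq R.
  + by move=> t tT; have [_ /(_ t tT)[->]] := Y_per.
  + move=> x xL; have zr : rect T L (0, x) by split.
    rewrite /dY /= big1 ?add0r; last first.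
      move=> i _; have [_ [_ _ _ y_0] _] := Hcy i.
      by rewrite [y_ i (0, x)](y_0 x xL) scaler0.
    by rewrite w_init subr0 D0_eq // addrC subrK.
- move=> x xL; rewrite /dY /=.
  (* At time [T] the [y_ i] are the basis vectors; adding [w T (x - T)] to [c (x - T)] leaves
     [d1 (x - T)], which is [D1 x]. *)
  have -> : \sum_i k i (T, x) *: y_ i (T, x) = c (x - T).
    rewrite [RHS]row_sum_delta; apply: eq_bigr => i _.
    by have [_ _ y_T] := Hcy i; rewrite [y_ i (T, x)](y_T x xL).
  by rewrite /c /d1 !subrK D1_eq // addrC subrK.
- rewrite (_ : (fun z => _) = dY); last by apply/funext => z; rewrite addrC addKr.
  apply: (C1norm_rect_le hL hT DdY) => z zr; split; apply: bound3.
  + apply: le_trans (ler_normD _ _) _; apply: lerD.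
      by apply: comb0_le => i; have [[]] := y_M i z zr.
    exact: le_trans (w_le _ _) rho_K.
  + apply: le_trans (ler_normD _ _) _; apply: lerD.
      by apply: combN_le => i; have [[]] := y_M i z zr.
    apply: le_trans (ler_normB _ _) _.
    (* The time derivative is the costliest quantity: [K + 1] for [wt] and 1 for [p]. *)
    have -> : (K + 2) * rho = (K + 1) * rho + rho by ring.
    by apply: lerD; [exact: wt_le|exact: p_le].
  + apply: le_trans (ler_normD _ _) _; apply: lerD.
      by apply: comb_le => i; have [[]] := y_M i z zr.
    exact: le_trans (p_le _ _) rho_K.
- rewrite (_ : (fun z => _) = dTh); last by apply/funext => z; rewrite addrC addKr.
  have le0 (x : R) : x <= 2 * M * n%:R * rho -> x <= eps.
    move=> xM; apply: bound3; apply: le_trans xM _.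
    by rewrite lerDl (le_trans (ltW rho0)).
  apply: (C1norm_rect_le hL hT DdTh) => z zr; split; apply: le0.
  + by apply: comb0_le => i; have [_ []] := y_M i z zr.
  + by apply: combN_le => i; have [_ []] := y_M i z zr.
  + by apply: comb_le => i; have [_ []] := y_M i z zr.
Qed.
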